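(* Let $X$ be a Banach space having a shrinking unconditional finite dimensional decomposition. Then every quotient of $X$ (i.e. every Banach space $Y$ for which there is a bounded linear operator from $X$ onto $Y$) has property (WU): every normalized weakly null sequence in $Y$ has an unconditional basic subsequence.
   Context: A finite dimensional decomposition (f.d.d.) of $X$ is a sequence $(E_n)$ of finite dimensional subspaces such that every $x\in X$ has a unique expansion $x=\sum_n x_n$ with $x_n\in E_n$. It is unconditional if these series converge unconditionally, and shrinking if the associated partial-sum projections $P_n$ satisfy $\|x^*|_{[E_j]_{j>n}}\|\to 0$ for every $x^*\in X^*$ (equivalently, $(E_n^* )$ is an f.d.d. of $X^*$). A Banach space $Y$ has property (WU) if every normalized weakly null sequence in $Y$ has an unconditional subsequence. *)

(* Defs.v *)
From HB Require Import structures.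
From mathcomp Require Import all_boot all_order all_algebra.
From mathcomp Require Import all_classical all_reals all_analysis.
Set Implicit Arguments. Unset Strict Implicit. Unset Printing Implicit Defensive.
Import Order.TTheory GRing.Theory Num.Theory.
Import numFieldNormedType.Exports.
Local Open Scope classical_set_scope.
Local Open Scope ring_scope.

Section Defs.
Context {R : realType}.

Definition is_linear (V W : normedModType R) (f : V -> W) : Prop :=
  forall (a : R) (x y : V), f (a *: x + y) = a *: f x + f y.

Definition bounded_linear (V W : normedModType R) (f : V -> W) : Prop :=
  is_linear f /\ continuous f.

Definition dual_elt (V : normedModType R) (f : V -> R^o) : Prop :=
  bounded_linear f.

Definition lin_span (V : normedModType R) (A : set V) : set V :=
  [set x | exists (n : nat) (c : 'I_n -> R) (v : 'I_n -> V),
      (forall i, A (v i)) /\ x = \sum_(i < n) c i *: v i].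

Definition closed_span (V : normedModType R) (A : set V) : set V :=
  closure (lin_span A).

Definition fin_dim_subspace (V : normedModType R) (E : set V) : Prop :=
  exists (n : nat) (b : 'I_n -> V), E = lin_span (range b).

Definition uncond_sum (V : normedModType R) (u : nat -> V) (x : V) : Prop :=
  forall sigma : nat -> nat, bijective sigma ->
    series (u \o sigma) @ \oo --> x.

Definition is_fdd (V : normedModType R) (E : nat -> set V) : Prop :=
  (forall n, fin_dim_subspace (E n)) /\
  (forall x : V, exists! u : nat -> V,
      (forall n, E n (u n)) /\ series u @ \oo --> x).

Definition is_uncond_fdd (V : normedModType R) (E : nat -> set V) : Prop :=
  is_fdd E /\
  (forall (x : V) (u : nat -> V), (forall n, E n (u n)) ->
      series u @ \oo --> x -> uncond_sum u x).

Definition fdd_tail (V : normedModType R) (E : nat -> set V) (n : nat) : set V :=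
  closed_span (\bigcup_(j in [set j | (n < j)%N]) E j).

Definition fdd_shrinking (V : normedModType R) (E : nat -> set V) : Prop :=
  forall f : V -> R^o, dual_elt f ->
    forall eps : R, 0 < eps -> exists N : nat, forall n : nat, (N <= n)%N ->
      forall y : V, fdd_tail E n y -> `|f y| <= eps * `|y|.

Definition has_shrinking_uncond_fdd (V : normedModType R) : Prop :=
  exists E : nat -> set V, is_uncond_fdd E /\ fdd_shrinking E.

Definition weakly_null (V : normedModType R) (x : nat -> V) : Prop :=
  forall f : V -> R^o, dual_elt f -> (fun n => f (x n)) @ \oo --> (0 : R^o).

Definition basic_seq (V : normedModType R) (x : nat -> V) : Prop :=
  forall y : V, closed_span (range x) y ->
    exists! a : nat -> R, series (fun n => a n *: x n) @ \oo --> y.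

Definition uncond_basic_seq (V : normedModType R) (x : nat -> V) : Prop :=
  basic_seq x /\
  (forall (y : V) (a : nat -> R), closed_span (range x) y ->
      series (fun n => a n *: x n) @ \oo --> y ->
      uncond_sum (fun n => a n *: x n) y).

Definition property_WU (V : normedModType R) : Prop :=
  forall x : nat -> V, (forall n, `|x n| = 1) -> weakly_null x ->
    exists phi : nat -> nat, (forall n, (phi n < phi n.+1)%N) /\
      uncond_basic_seq (x \o phi).

End Defs.

(* Main.v *)
Require Import Defs.
From HB Require Import structures.
From mathcomp Require Import all_boot all_order all_algebra.
From mathcomp Require Import all_classical all_reals all_analysis.
From mathcomp Require Import ring lra.

Set Implicit Arguments.
Unset Strict Implicit.
Unset Printing Implicit Defensive.
Import Order.TTheory GRing.Theory Num.Theory.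
Import numFieldNormedType.Exports.
Local Open Scope classical_set_scope.
Local Open Scope ring_scope.

(** Let [T : X -> Y] be onto, [S k] the partial sum projections of the
decomposition of [X], and [y] normalized and weakly null in [Y]. Since the
decomposition is shrinking, [g T S k] tends to [g T] in norm for every [g] in
the dual ball of [Y]; by compactness of that ball and finiteness of the rank of
[S k], for all [m] and [r] there are [n] and a finite set [L] of functionals in
the ball such that every [f] in the ball satisfies [|u T - f T S k| <= r] for
some [k] in [[m, n)] and some [u] in [L]. One chooses alternately a term
[y (phi i)] almost annihilated by all functionals found so far and a new window
[[m_i, n_i)] beyond which a lift of [y (phi i)] is negligible. For any [f] in
the ball this gives [u_j], and [D_j = u_j - u_(j-1)] is close to [f T] cut down
to a block of coordinates. Hence sums of the [D_j] over arbitrary sets of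
indices are uniformly bounded, because the decomposition is unconditional and
[T] is open, while [D_j (y (phi i))] is close to [f (y (phi i))] for [i = j] and
to [0] otherwise. Testing against norming functionals shows that [y \o phi] is
unconditional. *)

(** * Linear maps *)

Section LinearMaps.
Context {R : realType} {V W : normedModType R}.
Implicit Types f g : V -> W.

Definition linear_of f (lf : is_linear f) : {linear V -> W} :=
  HB.pack f (GRing.isLinear.Build _ _ _ _ _ lf).

Lemma is_linear0 f : is_linear f -> f 0 = 0.
Proof. by move=> lf; exact: (linear0 (linear_of lf)). Qed.

Lemma is_linearD f : is_linear f -> {morph f : x y / x + y}.
Proof. by move=> lf; exact: (linearD (linear_of lf)). Qed.

Lemma is_linearB f : is_linear f -> {morph f : x y / x - y}.
Proof. by move=> lf; exact: (linearB (linear_of lf)). Qed.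

Lemma is_linearZ f : is_linear f -> forall a, {morph f : x / a *: x}.
Proof. by move=> lf; exact: (linearZ_LR (linear_of lf)). Qed.

Lemma is_linear_sum f : is_linear f ->
  forall (I : Type) (r : seq I) (P : pred I) (E : I -> V),
    f (\sum_(i <- r | P i) E i) = \sum_(i <- r | P i) f (E i).
Proof. by move=> lf I r P E; exact: (raddf_sum (linear_of lf)). Qed.

Lemma is_linear_funB f g : is_linear f -> is_linear g -> is_linear (f \- g).
Proof.
move=> lf lg a x y /=; rewrite lf lg scalerBr opprD !addrA.
by congr (_ + _); rewrite -!addrA; congr (_ + _); rewrite addrC.
Qed.

Lemma bounded_linear_bound f : bounded_linear f ->
  exists2 M : R, 0 < M & forall x, `|f x| <= M * `|x|.
Proof.
move=> [lf cf].
have /linear_boundedP/pinfty_ex_gt0[M M0 fM] :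
    bounded_near (linear_of lf) (nbhs 0).
  exact/linear_bounded_continuous.
by exists M.
Qed.

Lemma bound_bounded_linear f (M : R) : is_linear f ->
  (forall x, `|f x| <= M * `|x|) -> bounded_linear f.
Proof.
move=> lf fM; split=> //.
apply: (@bounded_linear_continuous _ _ _ (linear_of lf)).
apply/bounded_funP => r; exists (`|M| * r) => x xr.
apply: le_trans (fM x) _; apply: le_trans (_ : `|M| * `|x| <= _).
  by rewrite ler_wpM2r// ler_norm.
by rewrite ler_wpM2l.
Qed.

End LinearMaps.

(** * Norming functionals *)

Section HahnBanach.
Context {R : realType} {V : normedModType R}.

(** Homogeneity is asked as an inequality for positive scalars only; scaling back by the inverse
    gives the converse. *)
Definition sublinear (p : V -> R) :=
  (forall x y, p (x + y) <= p x + p y) /\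
  (forall t x, 0 < t -> p (t *: x) <= t * p x).

Lemma sublinear_ge p x : sublinear p -> - p (- x) <= p x.
Proof.
move=> [pD _]; have := pD 0 0; rewrite addr0.
by have := pD x (- x); rewrite subrr; lra.
Qed.

Lemma sublinearZ_ge p t x : sublinear p -> 0 <= t -> t * p x <= p (t *: x).
Proof.
move=> sp; rewrite le_eqVlt => /predU1P[<-|t0].
  by rewrite scale0r mul0r; have := sp.1 0 0; rewrite addr0; lra.
rewrite mulrC -ler_pdivlMr// mulrC -{1}(scale1r x) -(mulVf (lt0r_neq0 t0)).
by rewrite -scalerA; apply: sp.2; rewrite invr_gt0.
Qed.

(** Lowers [p] along [z]: for sublinear [p] the result lies below [p], and [t = 1] shows that its
    value at [- z] is at most [- p z]. *)
Definition sublinear_shift (p : V -> R) (z x : V) : R :=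
  inf [set p (x + t *: z) - t * p z | t in [set t | 0 <= t]].

Lemma sublinear_shift_le p z x t : sublinear p -> 0 <= t ->
  sublinear_shift p z x <= p (x + t *: z) - t * p z.
Proof.
move=> sp t0; apply: ge_inf; last by exists t.
exists (- p (- x)) => _ [s /= s0 <-].
have := sublinearZ_ge z sp s0.
have := sp.1 (x + s *: z) (- x); rewrite addrAC subrr add0r; lra.
Qed.

Lemma le_sublinear_shift p z x c :
  (forall t, 0 <= t -> c <= p (x + t *: z) - t * p z) ->
  c <= sublinear_shift p z x.
Proof.
move=> cp; apply: lb_le_inf.
  by exists (p (x + 0 *: z) - 0 * p z), 0 => //=.
by move=> _ [t /= t0 <-]; exact: cp.
Qed.

Lemma sublinear_shift_sublinear p z :
  sublinear p -> sublinear (sublinear_shift p z).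
Proof.
move=> sp; split=> [x y|t x t0].
  rewrite -lerBlDr; apply: le_sublinear_shift => t t0.
  rewrite lerBlDl -lerBlDr; apply: le_sublinear_shift => s s0.
  have := sublinear_shift_le z (x + y) sp (addr_ge0 s0 t0).
  have := sp.1 (x + t *: z) (y + s *: z).
  rewrite addrACA -scalerDl [t + s]addrC; lra.
rewrite -ler_pdivrMl//; apply: le_sublinear_shift => s s0.
rewrite ler_pdivrMl//.
have := sublinear_shift_le z (t *: x) sp (mulr_ge0 (ltW t0) s0).
have := sp.2 t (x + s *: z) t0; rewrite scalerDr scalerA; lra.
Qed.

(** Zorn's lemma for the reversed pointwise order. A nonempty chain is bounded by its pointwise
    infimum, finite because every member is at least [- p (- x)] at [x]; comparability of two
    members keeps the infimum subadditive. *)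
Lemma minimal_sublinear p : sublinear p ->
  exists q, [/\ sublinear q, forall x, q x <= p x &
    forall r, sublinear r -> (forall x, r x <= q x) -> r = q].
Proof.
move=> sp; pose T := {q : V -> R | sublinear q /\ forall x, q x <= p x}.
pose le (q r : T) := `[< forall x, sval r x <= sval q x >].
have [| | | |[q [sq qp]] qmin] := @Zorn T le.
- by move=> q; apply/asboolP.
- move=> q r s /asboolP qr /asboolP rs; apply/asboolP => x.
  exact: le_trans (rs x) (qr x).
- move=> [q hq] [r hr] /asboolP/= qr /asboolP/= rq.
  apply: eq_exist => /=; apply/funext => x.
  by apply/eqP; rewrite eq_le qr rq.
- move=> A Atot; have [->|/set0P[q0 Aq0]] := eqVneq A set0.
    by exists (exist _ p (conj sp (fun=> lexx _))) => s.
  pose m x := inf [set sval q x | q in A].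
  have mle q x : A q -> m x <= sval q x.
    move=> Aq; apply: ge_inf; last by exists q.
    exists (- p (- x)) => _ [[r [sr rp]] /= Ar <-].
    by have := sublinear_ge x sr; have := rp (- x); lra.
  have lem c x : (forall q, A q -> c <= sval q x) -> c <= m x.
    move=> cq; apply: lb_le_inf; first by exists (sval q0 x), q0.
    by move=> _ [q /= Aq <-]; exact: cq.
  have sm : sublinear m.
    split=> [x y|t x t0].
      rewrite -lerBlDr; apply: (lem _ x) => q Aq.
      rewrite lerBlDl -lerBlDr; apply: (lem _ y) => r Ar.
      rewrite lerBlDl.
      have [/asboolP qr|/asboolP rq] := Atot _ _ Aq Ar.
        have := mle _ (x + y) Ar; have := qr x.
        by have := (svalP r).1.1 x y; lra.
      have := mle _ (x + y) Aq; have := rq y.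
      by have := (svalP q).1.1 x y; lra.
    rewrite -ler_pdivrMl//; apply: lem => q Aq; rewrite ler_pdivrMl//.
    exact: le_trans (mle _ _ Aq) ((svalP q).1.2 _ _ t0).
  have mp x : m x <= p x.
    exact: le_trans (mle _ _ Aq0) ((svalP q0).2 x).
  exists (exist _ m (conj sm mp)) => s As; apply/asboolP => x /=.
  exact: mle.
exists q; split=> // r sr rq.
have rp x : r x <= p x by exact: le_trans (rq x) (qp x).
suff /(congr1 sval) : exist _ r (conj sr rp) = exist _ q (conj sq qp) :> T by [].
by apply: qmin; apply/asboolP.
Qed.

(* A minimal [q] agrees with each of its shifts, which makes it superadditive. *)
Lemma hahn_banach_sublinear p : sublinear p ->
  exists2 q : V -> R^o, is_linear q & forall x, q x <= p x.
Proof.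
move=> /minimal_sublinear[q [sq qp qmin]]; exists q => //.
have qD x y : q (x + y) = q x + q y.
  apply/eqP; rewrite eq_le sq.1 /=.
  have qy : sublinear_shift q y = q.
    apply: qmin; first exact: sublinear_shift_sublinear.
    by move=> z; have := sublinear_shift_le y z sq (lexx 0);
      rewrite scale0r mul0r addr0 subr0.
  by have := sublinear_shift_le y x sq ler01; rewrite scale1r mul1r qy; lra.
have q0 : q 0 = 0 by have := qD 0 0; rewrite addr0; lra.
have qN x : q (- x) = - q x by have := qD x (- x); rewrite subrr q0; lra.
have qZp t x : 0 <= t -> q (t *: x) = t * q x.
  rewrite le_eqVlt => /predU1P[<-|t0]; first by rewrite scale0r mul0r q0.
  by apply/eqP; rewrite eq_le sq.2//= sublinearZ_ge// ltW.
move=> a x y; rewrite qD; congr (_ + _).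
rewrite -[RHS]/(a * q x); have [a0|a0] := leP 0 a; first exact: qZp.
by rewrite -[a *: x]opprK qN -scaleNr qZp ?oppr_ge0 ?ltW// mulNr opprK.
Qed.

(** A linear functional below the norm shifted along [z] is below the norm itself, and its value at
    [- z] is at most [- |z|], so it norms [z]. *)
Lemma norming_functional (z : V) :
  exists f : V -> R^o, [/\ is_linear f, forall x, `|f x| <= `|x| & f z = `|z|].
Proof.
have sn : sublinear (fun x : V => `|x|).
  split=> [x y|t x t0]; first exact: ler_normD.
  by rewrite normrZ gtr0_norm.
have [f lf fn] := hahn_banach_sublinear (sublinear_shift_sublinear z sn).
have fN x : f (- x) = - f x by rewrite -[- x]add0r is_linearB// is_linear0// sub0r.
have fle x : f x <= `|x|.
  apply: le_trans (fn x) _.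
  by have := sublinear_shift_le z x sn (lexx 0);
    rewrite scale0r mul0r addr0 subr0.
have fabs x : `|f x| <= `|x|.
  by rewrite ler_norml fle andbT lerNl -fN -[`|x|]normrN fle.
exists f; split=> //; apply/eqP; rewrite eq_le fle /=.
have := fn (- z); have := sublinear_shift_le z (- z) sn ler01.
by rewrite scale1r addNr normr0 mul1r sub0r fN; lra.
Qed.

End HahnBanach.

(** * Convergence of sequences *)

Section Sequences.
Context {R : realType}.

Lemma cvg_seqP (V : normedModType R) (u : nat -> V) (l : V) :
  u @ \oo --> l <->
  forall e : R, 0 < e -> exists N, forall n, (N <= n)%N -> `|u n - l| <= e.
Proof.
split=> [/cvgrPdist_le ul e e0|ul].
  have [N _ uN] := ul e e0; exists N => n Nn; rewrite distrC; exact: uN.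
apply/cvgrPdist_le => e e0; have [N uN] := ul e e0.
by exists N => // n /= Nn; rewrite distrC; exact: uN.
Qed.

Lemma cauchy_seq_cvg (V : completeNormedModType R) (u : nat -> V) :
  (forall e : R, 0 < e -> exists N, forall n, (N <= n)%N -> `|u n - u N| <= e) ->
  exists l : V, u @ \oo --> l.
Proof.
move=> uC; apply/cvg_ex; apply: cauchy_cvg; apply: cauchy_exP => e e0.
have [N uN] := uC (e / 2) (divr_gt0 e0 (ltr0n _ 2)).
exists (u N), N => // n /= Nn; rewrite -ball_normE /ball_ /= distrC.
by apply: le_lt_trans (uN n Nn) _; rewrite ltr_pdivrMr// ltr_pMr// ltr1n.
Qed.

Lemma half_pow_gt0 n : 0 < 2^-1 ^+ n :> R.
Proof. by rewrite exprn_gt0// invr_gt0. Qed.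

Lemma half_pow_le i j : (j <= i)%N -> 2^-1 ^+ i <= 2^-1 ^+ j :> R.
Proof.
by move=> ji; apply: ler_wiXn2l => //; rewrite ?invr_ge0// invf_le1// ler1n.
Qed.

Lemma half_pow_small (c e : R) : 0 < e ->
  exists N, forall n, (N <= n)%N -> c * 2^-1 ^+ n <= e.
Proof.
move=> e0; pose N := (Num.truncn (`|c| / e)).+1.
exists N => n Nn; apply: le_trans (_ : `|c| * 2^-1 ^+ n <= _).
  by rewrite ler_wpM2r ?ler_norm// ltW// half_pow_gt0.
rewrite exprVn ler_pdivrMr ?exprn_gt0// mulrC -ler_pdivrMr//.
have : `|c| / e < N%:R by exact: Num.Theory.truncnS_gt.
move=> /ltW/le_trans; apply; rewrite -natrX ler_nat.
by apply: (leq_trans Nn); exact/ltnW/ltn_expl.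
Qed.

Lemma half_pow_series n : \sum_(0 <= k < n) 2^-1 ^+ k = 2 * (1 - 2^-1 ^+ n) :> R.
Proof.
elim: n => [|n IH]; first by rewrite big_geq// expr0 subrr mulr0.
by rewrite big_nat_recr//= IH exprS; field.
Qed.

Lemma half_pow_series_le n : \sum_(0 <= k < n) 2^-1 ^+ k <= 2 :> R.
Proof. by rewrite half_pow_series; have := half_pow_gt0 n; lra. Qed.

Lemma half_pow_tail_le m n :
  \sum_(m <= k < n) 2^-1 ^+ k <= 2 * 2^-1 ^+ m :> R.
Proof.
have [mn|nm] := leqP m n; last first.
  by rewrite big_geq ?(ltnW nm)//; have := half_pow_gt0 m; lra.
have := half_pow_series n; rewrite (big_cat_nat (leq0n m) mn)/= half_pow_series.
by have := half_pow_gt0 n; lra.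
Qed.

Lemma norm_cvg_le (V : normedModType R) (u : nat -> V) (l : V) (c : R) N :
  u @ \oo --> l -> (forall n, (N <= n)%N -> `|u n| <= c) -> `|l| <= c.
Proof.
move=> /cvg_seqP ul uc; rewrite leNgt; apply/negP => cl.
have [M uM] := ul ((`|l| - c) / 2) ltac:(lra).
have := uM (maxn M N) (leq_maxl _ _); have := uc (maxn M N) (leq_maxr _ _).
have := ler_distD (u (maxn M N)) l 0; rewrite !subr0 distrC; lra.
Qed.

Lemma half_pow_series_cvg (V : completeNormedModType R) (u : nat -> V) (c : R) :
  (forall k, `|u k| <= c * 2^-1 ^+ k) ->
  exists2 l : V, series u @ \oo --> l & forall n, `|l - series u n| <= 2 * c * 2^-1 ^+ n.
Proof.
move=> uc.
have uB m n : (m <= n)%N -> `|series u n - series u m| <= 2 * c * 2^-1 ^+ m.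
  move=> mn; rewrite sub_series mn; apply: le_trans (ler_norm_sum _ _ _) _.
  apply: le_trans (ler_sum _ (fun k _ => uc k)) _.
  rewrite -mulr_sumr -mulrA mulrCA ler_wpM2l ?half_pow_tail_le//.
  by have := uc 0%N; rewrite expr0 mulr1; apply: le_trans.
have [|l ul] := @cauchy_seq_cvg _ (series u).
  move=> e e0; have [N Ne] := half_pow_small (2 * c) e0.
  by exists N => n Nn; apply: le_trans (uB _ _ Nn) (Ne N (leqnn N)).
exists l => // n; apply: (@norm_cvg_le _ (fun k => series u k - series u n) _ _ n).
  by apply: cvgB => //; exact: cvg_cst.
by move=> k; exact: uB.
Qed.

End Sequences.

(** * Absorbing sets and the open mapping theorem *)

Section Absorbing.
Context {R : realType} {V : completeNormedModType R}.
Variable A : set V.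
Hypotheses (Amid : forall a b, A a -> A b -> A (2^-1 *: (a + b)))
  (AN : forall a, A a -> A (- a))
  (Aabs : forall x, exists n, A (n.+1%:R^-1 *: x)).

(** The dilates of [A] cover [V], so by Baire's theorem the closure of one of them contains a
    ball. *)
Lemma absorbing_dense_ball : exists n (x : V) (r : R), 0 < r /\
  forall h, `|h - x| < r -> forall e : R, 0 < e ->
    exists2 a, A a & `|h - n.+1%:R *: a| < e.
Proof.
pose B n := [set n.+1%:R *: a | a in A].
have : ~ forall n, open (~` closure (B n)) /\ dense (~` closure (B n)).
  move=> /Baire /(_ setT)[| |x [_ xB]].
  - by exists 0.
  - exact: openT.
  have [n An] := Aabs x; apply: (xB n) => //; apply: subset_closure.
  by exists (n.+1%:R^-1 *: x) => //; rewrite scalerA divff ?scale1r.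
move=> /existsNP[n /not_andP[[]|]].
  by apply: closed_openC; exact: closed_closure.
move=> /denseNE[U [[x xU] /disjoints_subset UB]].
have [r /= r0 xrU] := (nbhs_ballP _ _).1 (open_nbhs_nbhs xU).
exists n, x, r; split=> // h hx e e0.
have /UB : U h by apply: xrU; rewrite -ball_normE /ball_ /= distrC.
rewrite setCK => /(_ (ball h e))[|_ [[a Aa <-]]]; first exact: nbhsx_ballx.
by rewrite -ball_normE; exists a.
Qed.

(** The ball found above is moved to the origin: if multiples of [a] and [b] approximate [z + h] and
    [z - h], the same multiple of half of [a - b] approximates [h]. Scaling then gives all radii. *)
Lemma absorbing_approx : exists2 c : R, 0 < c &
  forall x (d : R), 0 < d -> `|x| <= d ->
    exists2 a, A a & `|x - (c * d) *: a| <= d / 2.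
Proof.
have [n [z [r [r0 zr]]]] := absorbing_dense_ball.
have h0 h e : `|h| < r -> 0 < e -> exists2 a, A a & `|h - n.+1%:R *: a| < e.
  move=> hr e0.
  have [|a Aa ha] := zr (z + h) _ e e0; first by rewrite addrAC subrr add0r.
  have [|b Ab hb] := zr (z - h) _ e e0.
    by rewrite addrAC subrr add0r normrN.
  exists (2^-1 *: (a + - b)); first by apply: Amid => //; exact: AN.
  rewrite (_ : _ - _ = 2^-1 *: ((z + h - n.+1%:R *: a) - (z - h - n.+1%:R *: b))).
    rewrite normrZ gtr0_norm//.
    have := ler_normB (z + h - n.+1%:R *: a) (z - h - n.+1%:R *: b); lra.
  have -> (p q : V) : (z + h - p) - (z - h - q) = (h + h) - (p - q).
    have <- : z + h - (z - h) = h + h.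
      by rewrite opprB [z + h]addrC addrACA subrr addr0.
    by rewrite [- (p - q)]opprD addrACA -opprD.
  rewrite -scalerBr [RHS]scalerBr [2^-1 *: (h + h)]scalerDr.
  rewrite -scalerDl scalerA mulrC -scalerA.
  have -> : 2^-1 + 2^-1 = 1 :> R by lra.
  by rewrite scale1r.
exists (2 * n.+1%:R / r); first by rewrite divr_gt0// mulr_gt0.
(* Scaling by [r / (2 * d)] puts [x] within radius [r]; an error [r / 4] there is an error [d / 2]
   for [x]. *)
move=> x d d0 xd; have k0 : 0 < r / (2 * d) by rewrite divr_gt0// mulr_gt0.
have [| |a Aa xa] := h0 ((r / (2 * d)) *: x) (r / 4).
- rewrite normrZ gtr0_norm// -ltr_pdivlMl//; apply: le_lt_trans xd _.
  have -> : (r / (2 * d))^-1 * r = 2 * d by field; rewrite !gt_eqF.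
  by lra.
- by rewrite divr_gt0.
exists a => //; rewrite -(ler_pM2l k0) -{1}(gtr0_norm k0) -normrZ scalerBr scalerA.
have -> : r / (2 * d) * (2 * n.+1%:R / r * d) = n.+1%:R :> R.
  by field; rewrite !gt_eqF.
apply: le_trans (ltW xa) _; rewrite le_eqVlt; apply/orP; left; apply/eqP.
by field; rewrite gt_eqF.
Qed.

(** Successive approximation: each remainder is approximated again at half the previous scale. This
    serves both the open mapping theorem and the uniform bound on coordinate projections. *)
Lemma absorbing_series : exists2 C : R, 0 < C &
  forall x, exists2 a : nat -> V, forall k, A (a k) &
    series (fun k => (C * `|x| * 2^-1 ^+ k) *: a k) @ \oo --> x.
Proof.
have [c c0 cA] := absorbing_approx; exists c => // x.
have [->|x0] := eqVneq x 0.
  have [n] := Aabs 0; rewrite scaler0 => A0; exists (fun=> 0) => //.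
  rewrite (_ : series _ = fun=> 0); first exact: cvg_cst.
  by apply/funext => n0; rewrite seriesEnat/= big1// => i _; rewrite scaler0.
have xgt0 : 0 < `|x| by rewrite normr_gt0.
have /choice[g gA] : forall p : V * R, exists a,
    0 < p.2 -> `|p.1| <= p.2 -> A a /\ `|p.1 - (c * p.2) *: a| <= p.2 / 2.
  move=> [y d] /=; have [d0|] := ltP 0 d; last by exists 0.
  have [yd|] := leP `|y| d; last by exists 0.
  by have [a] := cA y d d0 yd; exists a.
pose d k := `|x| * 2^-1 ^+ k.
pose y := fix y k := if k is k'.+1 then y k' - (c * d k') *: g (y k', d k') else x.
have d0 k : 0 < d k by rewrite mulr_gt0// half_pow_gt0.
have yd k : `|y k| <= d k.
  elim: k => [|k IH] /=; first by rewrite /d expr0 mulr1.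
  have [_] := gA (y k, d k) (d0 k) IH; move=> /le_trans; apply => /=.
  by rewrite /d exprS; lra.
exists (fun k => g (y k, d k)).
  by move=> k; have [] := gA (y k, d k) (d0 k) (yd k).
have sE n : series (fun k => (c * `|x| * 2^-1 ^+ k) *: g (y k, d k)) n = x - y n.
  rewrite seriesEnat/=; elim: n => [|n IH]; first by rewrite big_geq// subrr.
  by rewrite big_nat_recr//= IH opprB addrA [in RHS]addrAC /d mulrA.
apply/cvg_seqP => e e0; have [N Ne] := half_pow_small `|x| e0.
exists N => n Nn; rewrite sE addrAC subrr add0r normrN.
exact: le_trans (yd n) (Ne n Nn).
Qed.

End Absorbing.

(** The image [A] of the unit ball is absorbing because [T] is onto. A series for [y] with terms in
    multiples of [A] lifts term by term to an absolutely convergent series in [X], whose geometric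
    bound gives the factor 2. *)
Lemma open_mapping {R : realType} {X Y : completeNormedModType R} (T : X -> Y) :
  bounded_linear T -> (forall y, exists x, T x = y) ->
  exists2 C : R, 0 < C & forall y, exists2 x, T x = y & `|x| <= C * `|y|.
Proof.
move=> bT sT; have [lT cT] := bT; have [M M0 TM] := bounded_linear_bound bT.
pose A := [set T x | x in [set x | `|x| <= 1]].
have Amid a b : A a -> A b -> A (2^-1 *: (a + b)).
  move=> [x /= x1 <-] [y /= y1 <-]; exists (2^-1 *: (x + y)) => /=.
    by rewrite normrZ gtr0_norm//; have := ler_normD x y; lra.
  by rewrite (is_linearZ lT) (is_linearD lT).
have AN a : A a -> A (- a).
  move=> [x /= x1 <-]; exists (- x); first by rewrite /= normrN.
  by rewrite -sub0r (is_linearB lT) (is_linear0 lT) sub0r.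
have Aabs y : exists n, A (n.+1%:R^-1 *: y).
  have [x <-] := sT y; exists (Num.truncn `|x|), ((Num.truncn `|x|).+1%:R^-1 *: x) => /=.
    rewrite normrZ ger0_norm// ler_pdivrMl// mulr1 ltW//.
    exact: Num.Theory.truncnS_gt.
  by rewrite (is_linearZ lT).
have [C C0 CA] := absorbing_series Amid AN Aabs.
exists (2 * C); first by rewrite mulr_gt0.
move=> y; have [a Aa ay] := CA y.
have /choice[b ab] : forall k, exists x, `|x| <= 1 /\ T x = a k.
  by move=> k; have [x] := Aa k; exists x.
pose u k := (C * `|y| * 2^-1 ^+ k) *: b k.
have uB k : `|u k| <= C * `|y| * 2^-1 ^+ k.
  have h : 0 <= C * `|y| * 2^-1 ^+ k.
    by rewrite !mulr_ge0 ?(ltW C0)// ltW// half_pow_gt0.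
  by rewrite normrZ ger0_norm// ler_piMr// (ab k).1.
have [x ux xB] := half_pow_series_cvg uB.
exists x; last first.
  by have := xB 0%N; rewrite seriesEnat/= big_geq// subr0 expr0 mulr1 mulrA.
have Tu : T \o series u @ \oo --> T x by apply: continuous_cvg => //; exact: cT.
rewrite (_ : T \o series u = series (fun k => (C * `|y| * 2^-1 ^+ k) *: a k)) in Tu.
  by apply: cvg_unique Tu ay.
apply/funext => n; rewrite /= !seriesEnat/= (is_linear_sum lT).
by apply: eq_bigr => k _; rewrite /u (is_linearZ lT) (ab k).2.
Qed.

(** * Finite dimensional subspaces *)

Section FiniteDimension.
Context {R : realType} {V : normedModType R}.

Definition comb_span n (b : 'I_n -> V) : set V :=
  [set x | exists c : 'I_n -> R, x = \sum_(i < n) c i *: b i].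

Lemma lin_span_range n (b : 'I_n -> V) : lin_span (range b) = comb_span b.
Proof.
apply/seteqP; split=> x.
  move=> [m [c [v [vb ->]]]].
  have /choice[k kv] : forall i, exists j, b j = v i.
    by move=> i; have [j] := vb i; exists j.
  exists (fun j => \sum_(i < m | k i == j) c i).
  rewrite (partition_big k predT)//=; apply: eq_bigr => j _.
  by rewrite scaler_suml; apply: eq_bigr => i /eqP <-; rewrite kv.
by move=> [c ->]; exists n, c, b; split=> // i; exists i.
Qed.

Lemma comb_span_lin n (b : 'I_n -> V) (a : R) x y :
  comb_span b x -> comb_span b y -> comb_span b (a *: x + y).
Proof.
move=> [c ->] [d ->]; exists (fun i => a * c i + d i).
rewrite scaler_sumr -big_split/=; apply: eq_bigr => i _.
by rewrite scalerDl scalerA.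
Qed.

Lemma comb_span0 n (b : 'I_n -> V) : comb_span b 0.
Proof. by exists (fun=> 0); rewrite big1// => i _; rewrite scale0r. Qed.

Lemma comb_span_recl n (b : 'I_n.+1 -> V) (t : R) (c : 'I_n -> R) :
  \sum_i (if unlift ord0 i is Some j then c j else t) *: b i =
  t *: b ord0 + \sum_i c i *: b (lift ord0 i).
Proof.
rewrite big_ord_recl unlift_none; congr (_ + _).
by apply: eq_bigr => i _; rewrite liftK.
Qed.

(* The distance from a vector [v] outside the closed span of the others bounds
   the coefficient of [v]; closedness and the bound go through together. *)
Lemma comb_span_closed_bound n (b : 'I_n -> V) :
  (forall (u : nat -> V) x, (forall k, comb_span b (u k)) -> u @ \oo --> x ->
    comb_span b x) /\
  exists2 M : R, 0 <= M & forall x, comb_span b x ->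
    exists2 c : 'I_n -> R, x = \sum_(i < n) c i *: b i &
      forall i, `|c i| <= M * `|x|.
Proof.
elim: n b => [|n IH] b.
  split.
    move=> u x ub ux; exists (fun=> 0); rewrite big_ord0.
    have u0 k : u k = 0 by have [c ->] := ub k; rewrite big_ord0.
    move: ux; rewrite (_ : u = fun=> 0); last exact/funext.
    by move=> ux; apply: cvg_unique ux (cvg_cst 0).
  by exists 0 => // x [c ->]; exists c => // -[].
pose b' i := b (lift ord0 i); pose v := b ord0.
have [cl [M M0 bM]] := IH b'.
have sub x : comb_span b x -> exists t, comb_span b' (x - t *: v).
  move=> [c ->]; exists (c ord0); exists (fun i => c (lift ord0 i)).
  by rewrite big_ord_recl addrAC subrr add0r.
have sup t y : comb_span b' y -> comb_span b (t *: v + y).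
  by move=> [c ->]; eexists; rewrite -comb_span_recl; reflexivity.
have [vb|vNb] := pselect (comb_span b' v).
  have sub' x : comb_span b x -> comb_span b' x.
    move=> /sub[t xt]; rewrite -[x](subrK (t *: v)) addrC.
    exact: comb_span_lin.
  split=> [u x ub ux|].
    have := sup 0 x; rewrite scale0r add0r; apply.
    by apply: (cl u) => // k; exact/sub'/ub.
  exists M => // x /sub'/bM[c xc cM].
  exists (fun i => if unlift ord0 i is Some j then c j else 0).
    by rewrite comb_span_recl scale0r add0r.
  by move=> i; case: unliftP => [j _|_]//; rewrite normr0 mulr_ge0.
have [d d0 vd] : exists2 d : R, 0 < d & forall y, comb_span b' y -> d <= `|v - y|.
  apply: contrapT => nd; apply: vNb.
  have /choice[u uP] : forall k, exists y, comb_span b' y /\ `|v - y| < 2^-1 ^+ k.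
    move=> k; apply: contrapT => nk; apply: nd; exists (2^-1 ^+ k).
      exact: half_pow_gt0.
    by move=> y yb; rewrite leNgt; apply/negP => ?; apply: nk; exists y.
  apply: (cl u) => [k|]; first exact: (uP k).1.
  apply/cvg_seqP => e e0; have [N Ne] := half_pow_small 1 e0; exists N => k Nk.
  rewrite distrC; apply: le_trans (ltW (uP k).2) _.
  by have := Ne k Nk; rewrite mul1r.
have td t y : comb_span b' y -> `|t| * d <= `|t *: v + y|.
  move=> yb; have [->|t0] := eqVneq t 0; first by rewrite normr0 mul0r.
  have -> : t *: v + y = t *: (v - - t^-1 *: y).
    by rewrite scaleNr opprK scalerDr scalerA divff// scale1r.
  rewrite normrZ ler_wpM2l//; apply: vd.
  rewrite -[_ *: y]addr0; apply: comb_span_lin => //; exact: comb_span0.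
split.
  move=> u x ub ux.
  have /choice[t tb] : forall k, exists t, comb_span b' (u k - t *: v).
    by move=> k; exact: sub.
  (* This makes the coefficients of [v] along [u] a Cauchy sequence; removing that component leaves
     a convergent sequence in the smaller span. *)
  have tB k l : `|t k - t l| * d <= `|u k - u l|.
    have e (p q U W : V) : p - q + (- 1 *: (W - q) + (U - p)) = U - W.
      rewrite scaleN1r opprB addrA [p - q + (q - W)]addrA subrK.
      by rewrite addrC addrA subrK.
    rewrite -(e (t k *: v) (t l *: v)) -scalerBl; apply: td.
    exact: comb_span_lin.
  have [|r tr] := @cauchy_seq_cvg R R^o t.
    move=> e e0; have /cvg_seqP/(_ (e * d / 2))[|N uN] := ux.
      by rewrite divr_gt0// mulr_gt0.
    exists N => k Nk; rewrite -(ler_pM2r d0); apply: le_trans (tB _ _) _.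
    have := uN k Nk; have := uN N (leqnn N).
    have := ler_distD x (u k) (u N); rewrite [`|x - _|]distrC; lra.
  rewrite -[x](subrK (r *: v)) addrC; apply: sup.
  apply: (cl (fun k => u k - t k *: v)) => //.
  by apply: cvgB => //; apply: cvgZ => //; exact: cvg_cst.
(* The coefficient of [v] is controlled by [d^-1], the norm of [x - t *: v] by [1 + d^-1 |v|] times
   that of [x], and the other coefficients by [M] times the latter. *)
exists (d^-1 + M * (1 + d^-1 * `|v|)).
  by rewrite addr_ge0 ?invr_ge0 ?(ltW d0)// mulr_ge0// addr_ge0// mulr_ge0// invr_ge0 ltW.
move=> x /sub[t xt]; have [c xc cM] := bM _ xt.
have tx : `|t| <= d^-1 * `|x|.
  by rewrite mulrC ler_pdivlMr//; have := td t _ xt; rewrite addrC subrK.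
exists (fun i => if unlift ord0 i is Some j then c j else t).
  by rewrite comb_span_recl -xc addrC subrK.
move=> i; case: unliftP => [j _|_].
  apply: le_trans (cM j) _; rewrite mulrDl -mulrA.
  have : `|x - t *: v| <= (1 + d^-1 * `|v|) * `|x|.
    apply: le_trans (ler_normB _ _) _; rewrite normrZ.
    have := ler_wpM2r (normr_ge0 v) tx; lra.
  move=> /(ler_wpM2l M0); have : 0 <= d^-1 * `|x| by rewrite mulr_ge0// invr_ge0 ltW.
  by lra.
apply: le_trans tx _; rewrite ler_wpM2r// lerDl mulr_ge0//.
by rewrite addr_ge0// mulr_ge0// invr_ge0 ltW.
Qed.

End FiniteDimension.

(** * Unconditional sums *)

Section UnconditionalSums.
Context {R : realType} {V : normedModType R}.

(** Without a bound, every tail contains a finite set of indices whose sum has norm above 1.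
    Consecutive windows containing such sets are reordered so that the chosen indices come first;
    the partial sums of the rearranged series then keep jumping by more than 1. *)
Lemma uncond_sum_bounded (u : nat -> V) (x : V) : uncond_sum u x ->
  exists M : R, forall n (F : pred nat), `|\sum_(0 <= i < n | F i) u i| <= M.
Proof.
move=> ux; apply: contrapT => nM.
have /choice[g gP] : forall m, exists p : nat * pred nat,
    (m < p.1)%N /\ 1 < `|\sum_(m <= i < p.1 | p.2 i) u i|.
  move=> m; apply: contrapT => nm; apply: nM.
  (* Were all subset sums beyond [m] at most 1, adding the norms of the first [m] terms would bound
     every subset sum. *)
  exists (1 + \sum_(0 <= i < m) `|u i|) => n F.
  pose N := maxn n m.+1; pose G i := F i && (i < n)%N.
  have mN : (m <= N)%N by rewrite ltnW// leq_maxr.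
  have -> : \sum_(0 <= i < n | F i) u i = \sum_(0 <= i < N | G i) u i.
    rewrite [RHS](big_cat_nat (leq0n n)) ?leq_maxl//= [X in _ + X]big_nat_cond.
    rewrite [X in _ + X]big_pred0 ?addr0.
      rewrite [LHS]big_nat_cond [RHS]big_nat_cond; apply: eq_bigl => i.
      by rewrite /G; case: (ltnP i n) => //; rewrite ?andbF ?andbT.
    by move=> i; rewrite /G; case: (ltnP i n); rewrite ?andbF.
  rewrite (big_cat_nat (leq0n m) mN)/= addrC.
  apply: le_trans (ler_normD _ _) _; apply: lerD.
    rewrite leNgt; apply/negP => h; apply: nm; exists (N, G); split=> //=.
    exact: leq_maxr.
  apply: le_trans (ler_norm_sum _ _ _) _; rewrite big_mkcond/=.
  by apply: ler_sum => i _; case: ifP.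
pose N m := (g m).1; pose s m := [seq i <- index_iota m (N m) | (g m).2 i].
pose t m := [seq i <- index_iota m (N m) | predC (g m).2 i].
pose mm := fix mm k := if k is k'.+1 then N (mm k') else 0%N.
(* [L k] enumerates the indices below [mm k] window by window, the chosen ones of each window before
   the others. *)
pose L := fix L k := if k is k'.+1 then L k' ++ s (mm k') ++ t (mm k') else [::].
have mN m : (m < N m)%N by exact: (gP m).1.
have Lperm k : perm_eq (L k) (index_iota 0 (mm k)).
  elim: k => [|k IH] //=; rewrite /index_iota subn0.
  rewrite -(subnKC (ltnW (mN (mm k)))) iotaD add0n.
  apply: perm_cat; first by rewrite /index_iota subn0 in IH.
  exact/permPl/perm_filterC.
have Lsize k : size (L k) = mm k by rewrite (perm_size (Lperm k)) size_iota subn0.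
have Luniq k : uniq (L k) by rewrite (perm_uniq (Lperm k)) iota_uniq.
have kmm k : (k <= mm k)%N by elim: k => [|k IH] //=; exact: leq_ltn_trans IH (mN _).
have mmS k l : (k <= l)%N -> (mm k <= mm l)%N.
  move=> /subnK <-; elim: (l - k)%N => [|j IH] //; rewrite addSn /=.
  exact/ltnW/(leq_ltn_trans IH).
have Lpre k l i : (k <= l)%N -> (i < mm k)%N -> nth 0%N (L l) i = nth 0%N (L k) i.
  move=> kl ik; rewrite -(subnK kl); elim: (l - k)%N => [|j IH] //.
  by rewrite addSn /= nth_cat Lsize (leq_trans ik)// mmS// leq_addl.
(* [L i.+1] has at least [i.+1] entries, so the default is never returned, and later lists extend
   it. *)
pose sigma i := nth 0%N (L i.+1) i.
have sE k i : (i < mm k)%N -> sigma i = nth 0%N (L k) i.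
  move=> ik; rewrite /sigma; have [h|h] := leqP i.+1 k.
    by rewrite (@Lpre _ _ _ h).
  by rewrite (@Lpre k)// ltnW.
have sb : bijective sigma.
  rewrite -setTT_bijective; split=> // [i j _ _|y _].
    have ik : (i < mm (maxn i j).+1)%N.
      by apply: leq_trans (kmm _); rewrite ltnS leq_maxl.
    have jk : (j < mm (maxn i j).+1)%N.
      by apply: leq_trans (kmm _); rewrite ltnS leq_maxr.
    rewrite (sE _ _ ik) (sE _ _ jk) => /eqP.
    by rewrite nth_uniq ?Lsize// => /eqP.
  have yL : y \in L y.+1.
    by rewrite (perm_mem (Lperm _)) mem_index_iota (leq_trans _ (kmm _)).
  exists (index y (L y.+1)) => //.
  by rewrite (sE y.+1) ?nth_index// -Lsize index_mem.
have serE k n : (n <= mm k)%N -> series (u \o sigma) n = \sum_(i <- take n (L k)) u i.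
  move=> nk; rewrite seriesEnat/= [RHS](big_nth 0%N) size_take Lsize.
  have -> : (if (n < mm k)%N then n else mm k) = n.
    by case: ltnP => // h; apply/eqP; rewrite eqn_leq h nk.
  apply: eq_big_nat => i /andP[_ ini].
  by rewrite nth_take//= (sE k)// (leq_trans ini).
(* Two partial sums within one third of [x] differ by at most [2/3], while a chosen set contributes
   more than 1. *)
have /cvg_seqP/(_ 3^-1)[|k kP] := ux _ sb; first by rewrite invr_gt0.
have h1 := kP (mm k) (kmm k).
have h2 := kP (mm k + size (s (mm k)))%N (leq_trans (kmm k) (leq_addr _ _)).
have := (gP (mm k)).2; rewrite -/(N _) -big_filter -/(s _).
have -> : \sum_(i <- s (mm k)) u i =
    series (u \o sigma) (mm k + size (s (mm k)))%N - series (u \o sigma) (mm k).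
  rewrite (@serE k.+1); last by rewrite -[mm k.+1]Lsize /= !size_cat Lsize addnA leq_addr.
  rewrite (@serE k)// [take (mm k) _]take_oversize ?Lsize//= catA take_size_cat.
    by rewrite big_cat/= addrAC subrr add0r.
  by rewrite size_cat Lsize.
rewrite ltNge; case/negP.
have := ler_distD x (series (u \o sigma) (mm k + size (s (mm k)))%N)
  (series (u \o sigma) (mm k)).
by rewrite [`|x - _|]distrC; lra.
Qed.

End UnconditionalSums.

(** * Decompositions *)

Section Decompositions.
Context {R : realType} {X : completeNormedModType R}.
Variable E : nat -> set X.

Lemma fin_dim_subspace_lin (F : set X) (a : R) x y :
  fin_dim_subspace F -> F x -> F y -> F (a *: x + y).
Proof.
by move=> [n [b ->]]; rewrite lin_span_range; exact: comb_span_lin.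
Qed.

Lemma fin_dim_subspace_closed (F : set X) (u : nat -> X) x :
  fin_dim_subspace F -> (forall k, F (u k)) -> u @ \oo --> x -> F x.
Proof.
move=> [n [b ->]]; rewrite lin_span_range.
exact: (comb_span_closed_bound b).1.
Qed.

Lemma fdd_coordinates : is_fdd E -> exists c : nat -> X -> X,
  [/\ forall n, is_linear (c n), forall x n, E n (c n x),
      forall x, series (c^~ x) @ \oo --> x &
      forall x u, (forall n, E n (u n)) -> series u @ \oo --> x ->
        forall n, u n = c n x].
Proof.
move=> [Efin Euniq].
have /choice[c cP] : forall x : X, exists u : nat -> X,
    ((forall n, E n (u n)) /\ series u @ \oo --> x) /\
    forall v, (forall n, E n (v n)) -> series v @ \oo --> x -> u = v.
  move=> x; have [u [uP uu]] := Euniq x; exists u; split=> // v vE vx.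
  exact: uu.
have cu x u : (forall n, E n (u n)) -> series u @ \oo --> x ->
    forall n, u n = c x n by move=> uE ux n; rewrite ((cP x).2 u).
exists (fun n x => c x n); split=> //.
- move=> n a x y; rewrite -(cu _ (fun n => a *: c x n + c y n))//.
    move=> {}n; apply: fin_dim_subspace_lin => //.
      exact: (cP x).1.1.
    exact: (cP y).1.1.
  have -> : series (fun n => a *: c x n + c y n) =
      (fun n => a *: series (c x) n + series (c y) n).
    apply/funext => m; rewrite !seriesEnat/= scaler_sumr -big_split/=.
    by [].
  apply: cvgD; last exact: (cP y).1.2.
  by apply: cvgZ; [exact: cvg_cst|exact: (cP x).1.2].
- by move=> x n; exact: (cP x).1.1.
- by move=> x; exact: (cP x).1.2.
Qed.

Lemma is_linear_partial (c : nat -> X -> X) n (F : pred nat) :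
  (forall n, is_linear (c n)) ->
  is_linear (fun x => \sum_(0 <= i < n | F i) c i x).
Proof.
move=> lc a x y; rewrite scaler_sumr -big_split/=.
by apply: eq_bigr => i _; exact: lc.
Qed.

Lemma uncond_fdd_projections : is_uncond_fdd E ->
  exists (c : nat -> X -> X) (K : R),
  [/\ 0 < K, forall n, is_linear (c n), forall x n, E n (c n x),
      forall x, series (c^~ x) @ \oo --> x &
      forall n (F : pred nat) x, `|\sum_(0 <= i < n | F i) c i x| <= K * `|x|].
Proof.
move=> [fE uE]; have [c [lc cE cx cu]] := fdd_coordinates fE.
pose Q n (F : pred nat) x := \sum_(0 <= i < n | F i) c i x.
have lQ n F : is_linear (Q n F) by exact: is_linear_partial.
pose A := [set x | forall n F, `|Q n F x| <= 1].
have Amid a b : A a -> A b -> A (2^-1 *: (a + b)).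
  move=> Aa Ab n F; rewrite (is_linearZ (lQ n F)) (is_linearD (lQ n F)).
  rewrite normrZ gtr0_norm//; have := Aa n F; have := Ab n F.
  by have := ler_normD (Q n F a) (Q n F b); lra.
have AN a : A a -> A (- a).
  move=> Aa n F; rewrite -sub0r (is_linearB (lQ n F)) (is_linear0 (lQ n F)).
  by rewrite sub0r normrN.
have Aabs x : exists n, A (n.+1%:R^-1 *: x).
  have [M MP] := uncond_sum_bounded (uE _ _ (cE x) (cx x)).
  exists (Num.truncn M) => n F; rewrite (is_linearZ (lQ n F)) normrZ ger0_norm//.
  rewrite ler_pdivrMl// mulr1; apply: le_trans (MP n F) _.
  exact/ltW/Num.Theory.truncnS_gt.
have [C C0 CA] := absorbing_series Amid AN Aabs.
exists c, (2 * C); split=> //; first by rewrite mulr_gt0.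
move=> n F x; rewrite -/(Q n F x).
have [a Aa ax] := CA x; set w := fun k => _ in ax.
pose D := C * `|x|.
have D0 : 0 <= D by rewrite mulr_ge0// ltW.
have Qw m G k : `|Q m G (w k)| <= D * 2^-1 ^+ k.
  have h : 0 <= D * 2^-1 ^+ k by rewrite mulr_ge0// ltW// half_pow_gt0.
  rewrite /w (is_linearZ (lQ m G)) normrZ ger0_norm// ler_piMr//.
  exact: Aa.
have /choice[u uP] : forall i, exists l : X, series (c i \o w) @ \oo --> l.
  move=> i; have [|l] := @half_pow_series_cvg R X (c i \o w) D; last by exists l.
  move=> k; have := Qw i.+1 (pred1 i) k; rewrite /Q big_mkcond.
  rewrite big_nat_recr//= eqxx big_nat big1 ?add0r// => j /andP[_ ji].
  by rewrite ifN// ltn_eqF.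
have serc i m : c i (series w m) = series (c i \o w) m.
  by rewrite !seriesEnat/= (is_linear_sum (lc i)).
have Qcvg m G : (fun k => Q m G (series w k)) @ \oo --> \sum_(0 <= i < m | G i) u i.
  rewrite (_ : (fun k => _) = fun k => \sum_(0 <= i < m | G i) series (c i \o w) k).
    by apply: cvg_big => [|i _]; [exact: add_continuous|exact: uP].
  by apply/funext => k; apply: eq_bigr => i _; rewrite serc.
have Qu m G k : `|(\sum_(0 <= i < m | G i) u i) - Q m G (series w k)| <=
    2 * D * 2^-1 ^+ k.
  have [l wl lB] := @half_pow_series_cvg R X (Q m G \o w) D (Qw m G).
  have <- : l = \sum_(0 <= i < m | G i) u i.
    apply: cvg_unique wl _ => //.
    have -> : series (Q m G \o w) = fun k => Q m G (series w k).
      by apply/funext => j; rewrite !seriesEnat/= (is_linear_sum (lQ m G)).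
    exact: Qcvg.
  by have := lB k; rewrite !seriesEnat/= -(is_linear_sum (lQ m G)).
have uc i : u i = c i x.
  apply: cu => {i} [i|].
    apply: (fin_dim_subspace_closed (fE.1 i) _ (uP i)) => k.
    by rewrite -serc; exact: cE.
  (* First [k] is fixed so that truncating the series [w] costs little uniformly in [m]; then [m] is
     taken large for the single vector [series w k]. *)
  apply/cvg_seqP => e e0.
  have [N1 N1P] := half_pow_small (2 * D) (divr_gt0 e0 (ltr0n _ 3)).
  have /cvg_seqP/(_ _ (divr_gt0 e0 (ltr0n _ 3)))[N2 N2P] := ax.
  pose k := maxn N1 N2.
  have /cvg_seqP/(_ _ (divr_gt0 e0 (ltr0n _ 3)))[N3 N3P] := cx (series w k).
  exists N3 => m mN3.
  have := N1P k (leq_maxl _ _); have := N2P k (leq_maxr _ _).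
  have := N3P m mN3; have := Qu m predT k.
  rewrite -[series (c^~ (series w k)) m]/(Q m predT (series w k)).
  rewrite -[series u m]/(\sum_(0 <= i < m) u i).
  have := ler_distD (Q m predT (series w k)) (\sum_(0 <= i < m) u i) x.
  have := ler_distD (series w k) (Q m predT (series w k)) x.
  lra.
(* At [k = 0] the partial sum of [w] vanishes, and [Qu] becomes the bound by [2 * C * |x|]. *)
have w0 : series w 0%N = 0 by rewrite seriesEnat/= big_geq.
have := Qu n F 0%N; rewrite w0 (is_linear0 (lQ n F)) subr0.
rewrite expr0 mulr1 /D mulrA /Q.
by under eq_bigr do rewrite uc.
Qed.

(** Finite rank in a form suited to pointwise convergence: composed with the partial sum, [f] is
    small in norm once it is small on [B], which collects spanning families of the first [n]
    subspaces. *)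
Lemma fdd_finite_rank (c : nat -> X -> X) (K : R) n :
  is_fdd E -> 0 <= K -> (forall x n, E n (c n x)) ->
  (forall n x, `|c n x| <= K * `|x|) ->
  exists (B : seq X) (M : R), 0 <= M /\ forall f : X -> R^o, is_linear f ->
    forall x, `|f (\sum_(0 <= i < n) c i x)| <= M * (\sum_(b <- B) `|f b|) * `|x|.
Proof.
move=> [Efin _] K0 cE cK; elim: n => [|n [B [M [M0 BM]]]].
  exists [::], 0; split=> // f lf x.
  by rewrite big_geq// (is_linear0 lf) normr0 mul0r mul0r.
have [m [b Eb]] := Efin n.
have [_ [M' M'0 bM']] := comb_span_closed_bound b.
exists (B ++ [seq b i | i <- enum 'I_m]), (M + M' * K).
split; first by rewrite addr_ge0// mulr_ge0.
move=> f lf x; rewrite big_nat_recr//= (is_linearD lf) big_cat/=.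
have h1 : 0 <= \sum_(b <- B) `|f b| by exact: sumr_ge0.
have h2 : 0 <= \sum_(b <- [seq b i | i <- enum 'I_m]) `|f b| by exact: sumr_ge0.
apply: le_trans (ler_normD _ _) _.
apply: le_trans (lerD (BM f lf x) (lexx _)) _.
have [|a cxa aM] := bM' (c n x); first by rewrite -lin_span_range -Eb.
have : `|f (c n x)| <=
    M' * K * (\sum_(b <- [seq b i | i <- enum 'I_m]) `|f b|) * `|x|.
  rewrite {1}cxa (is_linear_sum lf) big_map big_enum/= mulrAC mulr_sumr.
  apply: le_trans (ler_norm_sum _ _ _) _; apply: ler_sum => i _.
  rewrite (is_linearZ lf) normrM ler_wpM2r//; apply: le_trans (aM i) _.
  by rewrite -mulrA ler_wpM2l.
have : 0 <= M * (\sum_(b <- [seq b i | i <- enum 'I_m]) `|f b|) * `|x|.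
  by rewrite !mulr_ge0.
have : 0 <= M' * K * (\sum_(b <- B) `|f b|) * `|x| by rewrite !mulr_ge0.
lra.
Qed.

Lemma fdd_tail_projection (c : nat -> X -> X) x n :
  (forall x n, E n (c n x)) -> series (c^~ x) @ \oo --> x ->
  fdd_tail E n (x - \sum_(0 <= i < n.+1) c i x).
Proof.
move=> cE cx B /nbhs_normP[e /= e0 eB].
have /cvg_seqP/(_ _ (divr_gt0 e0 (ltr0n _ 2)))[N NP] := cx.
exists (\sum_(i < N) c (n.+1 + i)%N x); split.
  exists N, (fun=> 1), (fun i => c (n.+1 + i)%N x); split.
    by move=> i; exists (n.+1 + i)%N => //=; rewrite addSn ltnS leq_addr.
  by apply: eq_bigr => i _; rewrite scale1r.
apply: eB => /=.
have -> : x - \sum_(0 <= i < n.+1) c i x - \sum_(i < N) c (n.+1 + i)%N x =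
    x - series (c^~ x) (n.+1 + N)%N.
  rewrite seriesEnat/= (big_cat_nat (leq0n n.+1) (leq_addr N _))/= opprD addrA.
  congr (_ - _ - _); rewrite -[in RHS](add0n n.+1) big_addn addKn big_mkord.
  by apply: eq_bigr => i _; rewrite addnC.
rewrite distrC; apply: le_lt_trans (NP _ (leq_addl _ _)) _; lra.
Qed.

(** The remainder of [x] has norm at most [(1 + K) |x|], hence the tolerance [e / (1 + K)]. After
    [n.+1] coordinates it lies in [fdd_tail E n], hence the bound [N.+1]. *)
Lemma shrinking_projection (c : nat -> X -> X) (K : R) : fdd_shrinking E ->
  (forall x n, E n (c n x)) -> (forall x, series (c^~ x) @ \oo --> x) ->
  (forall n x, `|\sum_(0 <= i < n) c i x| <= K * `|x|) -> 0 <= K ->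
  forall f : X -> R^o, dual_elt f -> forall e : R, 0 < e ->
  exists N, forall n, (N <= n)%N ->
    forall x, `|f (x - \sum_(0 <= i < n) c i x)| <= e * `|x|.
Proof.
move=> sE cE cx cK K0 f df e e0.
have K1 : 0 < 1 + K by lra.
have [N NP] := sE f df (e / (1 + K)) (divr_gt0 e0 K1).
exists N.+1 => -[//|n] Nn x.
have := NP n Nn _ (@fdd_tail_projection c x n cE (cx x)).
move=> /le_trans; apply.
rewrite mulrAC ler_pdivrMr// -mulrA ler_wpM2l ?(ltW e0)//.
by apply: le_trans (ler_normB _ _) _; have := cK n.+1 x; lra.
Qed.

End Decompositions.

(** * Compactness of the dual ball *)

(** The closed unit ball of the dual; continuity follows from the bound. *)
Definition unit_functional {R : realType} {V : normedModType R}
    (f : V -> R^o) : Prop :=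
  is_linear f /\ forall y, `|f y| <= `|y|.

(** At each [y] the values lie in the compact segment between [- |y|] and [|y|], where the
    ultrafilter converges. Linearity passes to the pointwise limit, since each instance of it
    involves only three values. *)
Lemma unit_functional_ultralimit {R : realType} {V : normedModType R}
    (G : set_system (V -> R^o)) : UltraFilter G -> G unit_functional ->
  exists2 g : V -> R^o, unit_functional g &
    forall y (e : R), 0 < e -> G [set f | `|f y - g y| <= e].
Proof.
move=> UG Gu; have PG : ProperFilter G by exact: ultra_proper.
have /choice[g gP] : forall y : V, exists p : R,
    `|p| <= `|y| /\ forall e : R, 0 < e -> G [set f | `|f y - p| <= e].
  move=> y; pose ev (f : V -> R^o) : R := f y.
  have FE : (ev @ G) `[- `|y|, `|y|]%classic.
    have sub : unit_functional `<=` ev @^-1` `[- `|y|, `|y|]%classic.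
      by move=> f [_ fy]; rewrite /= in_itv /= -ler_norml; exact: fy.
    exact: filterS sub Gu.
  have [p [py pcl]] := @segment_compact R (- `|y|) `|y| (ev @ G) _ FE.
  exists p; split; first by move: py; rewrite /= in_itv /= -ler_norml.
  move=> e e0; have [//|GN] := in_ultra_setVsetC [set f | `|f y - p| <= e] UG.
  have FN : (ev @ G) (ev @` (~` [set f | `|f y - p| <= e])).
    have sub : ~` [set f | `|f y - p| <= e] `<=`
        ev @^-1` (ev @` (~` [set f | `|f y - p| <= e])) by move=> f fN; exists f.
    exact: filterS sub GN.
  have [q [[f fN <-]]] := pcl _ _ FN (nbhsx_ballx p e e0).
  by rewrite -ball_normE /ball_ /= distrC => /ltW /fN.
have Gg y (e : R) : 0 < e -> G [set f | `|f y - g y| <= e] by move=> e0; exact: (gP y).2.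
exists g => //; split; last by move=> y; exact: (gP y).1.
move=> a x y; rewrite -[_ *: g x]/(a * g x).
apply/eqP; rewrite -subr_eq0 -normr_le0; apply/ler_addgt0Pl => e e0.
have a0 : 0 < 2 + `|a| by rewrite ltr_pwDl.
pose d := e / (2 + `|a|).
have d0 : 0 < d by rewrite divr_gt0.
have ed : e = 2 * d + `|a| * d by rewrite -mulrDl mulrC divfK// gt_eqF.
have [f [[[[lf _] /= h1] h2] h3]] := filter_ex (filterI (filterI (filterI Gu
  (Gg (a *: x + y) _ d0)) (Gg x _ d0)) (Gg y _ d0)).
move: h1; rewrite lf -[_ *: f x]/(a * f x) => h1.
have -> : g (a *: x + y) - (a * g x + g y) =
    - (a * f x + f y - g (a *: x + y)) + a * (f x - g x) + (f y - g y) by ring.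
rewrite addr0; apply: le_trans (ler_normD _ _) _.
apply: le_trans (lerD (ler_normD _ _) (lexx _)) _; rewrite normrN normrM.
have h4 := ler_wpM2l (normr_ge0 a) h2.
by rewrite [leRHS]ed; lra.
Qed.

(** * Finite nets for truncated functionals *)

Section FiniteNet.
Context {R : realType} {X Y : normedModType R}.
Variables (T : X -> Y) (S : nat -> X -> X).
Hypothesis T_bounded : bounded_linear T.
Hypothesis S_finite_rank : forall n, exists (B : seq X) (M : R), 0 <= M /\
  forall f : X -> R^o, is_linear f ->
  forall x, `|f (S n x)| <= M * (\sum_(b <- B) `|f b|) * `|x|.
Hypothesis S_shrinking : forall f : X -> R^o, dual_elt f ->
  forall e : R, 0 < e -> exists N, forall n, (N <= n)%N ->
    forall x, `|f (x - S n x)| <= e * `|x|.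

Let good (m n : nat) (e : R) (L : seq (Y -> R^o)) (f : Y -> R^o) :=
  exists k u, [/\ (m <= k < n)%N, u \in L &
    forall x, `|u (T x) - f (T (S k x))| <= e * `|x|].

(** The difference splits into [g T (x - S k x)], small by [S_shrinking] for large [k], and
    [(g - f) T S k x], small by finite rank once [f] is close to [g] on [B]. *)
Lemma functional_near_truncation g m (e : R) : unit_functional g -> 0 < e ->
  exists k (B : seq Y) (d : R), [/\ (m <= k)%N, 0 < d & forall f,
    is_linear f -> \sum_(b <- B) `|f b - g b| <= d ->
    forall x, `|g (T x) - f (T (S k x))| <= e * `|x|].
Proof.
move=> [lg gB] e0; have [lT _] := T_bounded.
have [MT MT0 TM] := bounded_linear_bound T_bounded.
have lgT : is_linear (g \o T : X -> R^o) by move=> a x y; rewrite /= lT lg.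
have dgT : dual_elt (g \o T : X -> R^o).
  by apply: (@bound_bounded_linear _ _ _ _ MT) => // x; exact: le_trans (gB _) (TM x).
have e2 : 0 < e / 2 by rewrite divr_gt0.
have [N NP] := S_shrinking dgT e2.
pose k := maxn m N; have [B [M [M0 BM]]] := S_finite_rank k.
have M1 : 0 < M + 1 by lra.
exists k, (map T B), (e / 2 / (M + 1)).
split; [exact: leq_maxl|exact: divr_gt0|].
move=> f lf fB x.
have lfT : is_linear (f \o T : X -> R^o) by move=> a y z; rewrite /= lT lf.
have h1 := NP k (leq_maxr _ _) x.
have h2 := BM _ (is_linear_funB lfT lgT) x.
have h3 : M * (\sum_(b <- B) `|f (T b) - g (T b)|) * `|x| <= e / 2 * `|x|.
  rewrite ler_wpM2r//; rewrite big_map in fB.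
  apply: le_trans (ler_wpM2l M0 fB) _.
  rewrite mulrCA ler_piMr ?(ltW e2)// ler_pdivrMr//; lra.
have -> : g (T x) - f (T (S k x)) = (g \o T) (x - S k x)
    - ((f \o T : X -> R^o) \- (g \o T : X -> R^o)) (S k x).
  rewrite (is_linearB lgT) /=; ring.
apply: le_trans (ler_normB _ _) _.
by have := le_trans h2 h3; lra.
Qed.

(** Otherwise the functionals missed by the pairs [n], [L] generate a proper filter. An ultrafilter
    refining it has a pointwise limit [g] in the ball, and functionals near [g] are captured by the
    list [[:: g]] and the window ending at [k.+1], a contradiction. *)
Lemma truncation_finite_net m (e : R) : 0 < e ->
  exists n (L : seq (Y -> R^o)), (forall u, u \in L -> unit_functional u) /\
    forall f, unit_functional f -> good m n e L f.
Proof.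
move=> e0; apply: contrapT => nnet.
pose F : set_system (Y -> R^o) := [set P | exists n (L : seq (Y -> R^o)),
  (forall u, u \in L -> unit_functional u) /\
  forall f, unit_functional f -> ~ good m n e L f -> P f].
have FF : ProperFilter F.
  split.
    move=> [n [L [Lu Lf]]]; apply: nnet; exists n, L; split=> // f uf.
    by apply: contrapT => nf; exact: Lf uf nf.
  split.
  - by exists 0%N, [::]; split.
  - move=> P Q [n [L [Lu LP]]] [n' [L' [L'u L'Q]]].
    exists (maxn n n'), (L ++ L'); split.
      by move=> u; rewrite mem_cat => /orP[/Lu|/L'u].
    move=> f uf nf; split.
      apply: LP => // -[k [u [/andP[mk kn] uL uP]]]; apply: nf; exists k, u.
      by split=> //; rewrite ?mem_cat ?uL// mk leq_max kn.
    apply: L'Q => // -[k [u [/andP[mk kn] uL uP]]]; apply: nf; exists k, u.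
    by split=> //; rewrite ?mem_cat ?uL ?orbT// mk leq_max kn orbT.
  - move=> P Q PQ [n [L [Lu LP]]]; exists n, L; split=> // f uf nf.
    exact/PQ/LP.
have [G [UG FG]] := ultraFilterLemma FF.
have Gu : G unit_functional by apply: FG; exists 0%N, [::].
have [g ug Gg] := unit_functional_ultralimit UG Gu.
have [k [B [d [mk d0 gP]]]] := functional_near_truncation m ug e0.
have PG : ProperFilter G by exact: ultra_proper.
have GB (r : R) : 0 < r -> G [set f | \sum_(b <- B) `|f b - g b| <= r].
  elim: (B) r => [|b B' IH] r r0.
    by apply: filterS filterT => f _ /=; rewrite big_nil ltW.
  have r2 : 0 < r / 2 by rewrite divr_gt0.
  apply: filterS (filterI (Gg b _ r2) (IH _ r2)) => f [/= h1 h2].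
  by rewrite big_cons; lra.
have GN : G [set f | ~ good m k.+1 e [:: g] f].
  apply: FG; exists k.+1, [:: g]; split=> // u.
  by rewrite inE => /eqP ->.
have [f [[[lf _] /= fB]]] := filter_ex (filterI (filterI Gu (GB _ d0)) GN).
apply; exists k, g; split; rewrite ?mk ?inE//=; exact: gP.
Qed.

End FiniteNet.

(** * Unconditional basic sequences *)

Section UnconditionalBound.
Context {R : realType} {V : normedModType R}.
Variable x : nat -> V.
Hypothesis x_normalized : forall n, `|x n| = 1.

Lemma lin_span_seq z : lin_span (range x) z ->
  exists (a : nat -> R) n, forall m, (n <= m)%N ->
    z = \sum_(0 <= i < m) a i *: x i.
Proof.
move=> [m [c [v [vx ->]]]]; elim: m c v vx => [|m IH] c v vx.
  exists (fun=> 0), 0%N => m _; rewrite big_ord0 big1// => i _.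
  by rewrite scale0r.
have [a [n aP]] := IH (fun i => c (lift ord0 i)) (fun i => v (lift ord0 i))
  (fun i => vx _).
have [k _ xk] := vx ord0.
exists (fun i => (if i == k then c ord0 else 0) + a i), (maxn n k.+1) => l.
rewrite geq_max => /andP[nl kl]; rewrite big_ord_recl (aP l nl) -xk.
under [RHS]eq_bigr do rewrite scalerDl.
rewrite big_split/=; congr (_ + _).
under [RHS]eq_bigr => i _ do rewrite (fun_if (fun r => r *: x i)) scale0r.
by rewrite -big_mkcond/= big_nat1_eq kl.
Qed.

Variable C : R.
Hypothesis C_ge0 : 0 <= C.
Hypothesis x_uncond : forall n (a : nat -> R) (F : pred nat),
  `|\sum_(0 <= i < n | F i) a i *: x i| <= C * `|\sum_(0 <= i < n) a i *: x i|.

Lemma uncond_coef_bound n (a : nat -> R) i : (i < n)%N ->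
  `|a i| <= C * `|\sum_(0 <= i < n) a i *: x i|.
Proof.
move=> ni; have := x_uncond n a (pred1 i).
by rewrite big_nat1_eq ni normrZ x_normalized mulr1.
Qed.

Lemma uncond_head_bound m n (a : nat -> R) : (m <= n)%N ->
  `|\sum_(0 <= i < m) a i *: x i| <= C * `|\sum_(0 <= i < n) a i *: x i|.
Proof.
move=> mn; have := x_uncond n a (fun i => (i < m)%N).
rewrite (big_cat_nat (leq0n m) mn)/= [X in _ + X]big_nat_cond.
rewrite [X in _ + X]big_pred0 ?addr0; last first.
  by move=> i; case: (ltnP i m); rewrite ?andbF.
congr (`|_| <= _); rewrite big_nat_cond [RHS]big_nat_cond.
by apply: eq_bigl => i; case: (ltnP i m); rewrite ?andbF.
Qed.

Lemma uncond_tail_bound m n (a : nat -> R) (F : pred nat) :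
  `|\sum_(m <= i < n | F i) a i *: x i| <= C * `|\sum_(m <= i < n) a i *: x i|.
Proof.
have [mn|nm] := leqP m n; last first.
  by rewrite big_geq ?(ltnW nm)// normr0 mulr_ge0.
pose a' i := if (i < m)%N then 0 else a i.
have tE G : \sum_(m <= i < n | G i) a i *: x i = \sum_(0 <= i < n | G i) a' i *: x i.
  have z : \sum_(0 <= i < m | G i) a' i *: x i = 0.
    rewrite big_nat_cond big1// => i /andP[/andP[_ im] _].
    by rewrite /a' im scale0r.
  rewrite (big_cat_nat (leq0n m) mn)/= z add0r.
  rewrite big_nat_cond [RHS]big_nat_cond; apply: eq_bigr => i.
  by case/andP=> /andP[mi _] _; rewrite /a' ltnNge mi.
by rewrite tE [X in C * `|X|]tE; exact: x_uncond.
Qed.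

Lemma uncond_bound_unique (a b : nat -> R) (y : V) :
  series (fun n => a n *: x n) @ \oo --> y ->
  series (fun n => b n *: x n) @ \oo --> y -> a = b.
Proof.
move=> /cvg_seqP ay /cvg_seqP yb; apply/funext => i; apply/eqP.
rewrite -subr_eq0 -normr_le0; apply/ler_addgt0Pl => e e0; rewrite addr0.
have C1 : 0 < 2 * (C + 1) by move: C_ge0; lra.
have [N NP] := ay _ (divr_gt0 e0 C1); have [M MP] := yb _ (divr_gt0 e0 C1).
pose n := maxn i.+1 (maxn N M).
have ni : (i < n)%N by rewrite leq_max leqnn.
have h1 := NP n ltac:(by rewrite !leq_max leqnn orbT).
have h2 := MP n ltac:(by rewrite !leq_max leqnn !orbT).
apply: le_trans (uncond_coef_bound (fun i => a i - b i) ni) _.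
have -> : \sum_(0 <= i < n) (a i - b i) *: x i =
    series (fun n => a n *: x n) n - series (fun n => b n *: x n) n.
  rewrite !seriesEnat/= -sumrB; apply: eq_bigr => j _; exact: scalerBl.
have := ler_distD y (series (fun n => a n *: x n) n) (series (fun n => b n *: x n) n).
rewrite [`|y - _|]distrC => h3.
have : `|series (fun n => a n *: x n) n - series (fun n => b n *: x n) n|
    <= e / (C + 1).
  apply: le_trans h3 _; apply: le_trans (lerD h1 h2) _.
  rewrite le_eqVlt; apply/orP; left; apply/eqP; field; rewrite gt_eqF//.
  by move: C_ge0; lra.
move=> /(ler_wpM2l C_ge0)/le_trans; apply.
rewrite mulrCA ler_piMr ?(ltW e0)// ler_pdivrMr; move: C_ge0; lra.
Qed.

(** The coefficients of finite combinations approximating [y] are Cauchy one by one. The bounds on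
    partial sums of their differences are uniform in the number of terms, so they pass to the limit
    coefficients and give convergence. *)
Lemma uncond_bound_expansion (y : V) : closed_span (range x) y ->
  exists a : nat -> R, series (fun n => a n *: x n) @ \oo --> y.
Proof.
move=> ycl.
have /choice[p pP] : forall k : nat, exists p : (nat -> R) * nat,
    forall m, (p.2 <= m)%N -> `|\sum_(0 <= i < m) p.1 i *: x i - y| <= 2^-1 ^+ k.
  move=> k; have [|z [zx]] := ycl (ball y (2^-1 ^+ k)).
    exact/nbhsx_ballx/half_pow_gt0.
  rewrite -ball_normE /ball_ /= distrC => zy.
  have [a [n aP]] := lin_span_seq zx; exists (a, n) => m /= nm.
  by rewrite -aP// ltW.
pose a k := (p k).1.
have aB k l n : (k <= l)%N ->
    `|\sum_(0 <= i < n) (a l i - a k i) *: x i| <= 2 * C * 2^-1 ^+ k.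
  move=> kl; pose N := maxn n (maxn (p k).2 (p l).2).
  have nN : (n <= N)%N by rewrite leq_max leqnn.
  apply: le_trans (uncond_head_bound _ nN) _.
  rewrite -mulrA mulrCA ler_wpM2l//.
  under eq_bigr do rewrite scalerBl.
  rewrite sumrB.
  have h1 := pP k N ltac:(by rewrite !leq_max leqnn orbT).
  have h2 := pP l N ltac:(by rewrite !leq_max leqnn !orbT).
  have h3 := half_pow_le (R := R) kl.
  have := ler_distD y (\sum_(0 <= i < N) a l i *: x i) (\sum_(0 <= i < N) a k i *: x i).
  rewrite [`|y - _|]distrC => /le_trans; apply.
  by apply: le_trans (lerD h2 h1) _; lra.
have /choice[b bP] : forall i, exists r : R^o, (fun k => a k i : R^o) @ \oo --> r.
  move=> i; apply: cauchy_seq_cvg => e e0.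
  have C0 : 0 <= C * (2 * C) by rewrite !mulr_ge0.
  have [N NP] := half_pow_small (C * (2 * C)) e0; exists N => k Nk.
  apply: le_trans (uncond_coef_bound (fun i => a k i - a N i) (ltnSn i)) _.
  apply: le_trans (ler_wpM2l C_ge0 (aB _ _ _ Nk)) _.
  by rewrite mulrA; exact: NP.
have bB k n : `|\sum_(0 <= i < n) (b i - a k i) *: x i| <= 2 * C * 2^-1 ^+ k.
  apply: (@norm_cvg_le R V (fun l => \sum_(0 <= i < n) (a l i - a k i) *: x i) _ _ k).
    apply: cvg_big => [|i _]; first exact: add_continuous.
    apply: cvgZ; last exact: cvg_cst.
    by apply: cvgB; [exact: bP|exact: cvg_cst].
  by move=> l kl; exact: aB.
exists b; apply/cvg_seqP => e e0.
have [k kP] := half_pow_small (2 * C + 1) e0.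
exists (p k).2 => n pn; rewrite seriesEnat/=.
have h1 : `|\sum_(0 <= i < n) b i *: x i - \sum_(0 <= i < n) a k i *: x i| <=
    2 * C * 2^-1 ^+ k.
  by rewrite -sumrB; under eq_bigr do rewrite -scalerBl; exact: bB.
have h2 := pP k n pn; have h3 := kP k (leqnn k).
have := ler_distD (\sum_(0 <= i < n) a k i *: x i) (\sum_(0 <= i < n) b i *: x i) y.
by rewrite /a in h1 *; lra.
Qed.

Lemma uncond_bound_rearrange (a : nat -> R) (y : V) :
  series (fun n => a n *: x n) @ \oo --> y ->
  uncond_sum (fun n => a n *: x n) y.
Proof.
move=> /cvg_seqP ay s [t st ts]; apply/cvg_seqP => e e0.
(* The head contributes one error, the tail [C] times two errors. *)
have C1 : 0 < 2 * C + 1 by move: C_ge0; lra.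
have [N NP] := ay _ (divr_gt0 e0 C1).
(* From here on the first [n] rearranged terms consist of all terms below [N] and a subset of those
   from [N] to [m]. *)
exists (\max_(0 <= i < N) (t i).+1)%N => n tn.
have tN i : (i < N)%N -> (t i < n)%N.
  move=> iN; apply: leq_trans tn.
  by rewrite (bigD1_seq i) ?mem_index_iota ?iota_uniq//= leq_maxl.
pose m := maxn N (\max_(0 <= i < n) (s i).+1)%N.
have sm i : (i < n)%N -> (s i < m)%N.
  move=> ni; rewrite leq_max; apply/orP; right.
  by rewrite (bigD1_seq i) ?mem_index_iota ?iota_uniq//= leq_maxl.
have Nm : (N <= m)%N by exact: leq_maxl.
have -> : series ((fun n => a n *: x n) \o s) n =
    \sum_(0 <= j < m | (t j < n)%N) a j *: x j.
  rewrite seriesEnat/= -(big_map s predT (fun j => a j *: x j)) -[RHS]big_filter.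
  apply: perm_big; apply: uniq_perm.
  - by rewrite map_inj_uniq ?iota_uniq//; exact: can_inj st.
  - by rewrite filter_uniq// iota_uniq.
  move=> j; rewrite mem_filter mem_index_iota /=; apply/mapP/andP.
    move=> [i]; rewrite mem_index_iota /= => ni ->; rewrite st ni; split=> //.
    exact: sm.
  by move=> [tj jm]; exists (t j); rewrite ?ts// mem_index_iota.
rewrite (big_cat_nat (leq0n N) Nm)/=.
have -> : \sum_(0 <= j < N | (t j < n)%N) a j *: x j =
    series (fun n => a n *: x n) N.
  rewrite seriesEnat/= big_nat_cond [RHS]big_nat_cond; apply: eq_bigl => j.
  by rewrite andbT; case: (ltnP j N) => [/tN ->//|]; rewrite ?andbF.
have h1 := NP N (leqnn N); have h2 := NP m Nm.
have h3 := uncond_tail_bound N m a (fun j => (t j < n)%N).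
have h4 : `|\sum_(N <= i < m) a i *: x i| <= 2 * (e / (2 * C + 1)).
  have -> : \sum_(N <= i < m) a i *: x i =
      series (fun n => a n *: x n) m - series (fun n => a n *: x n) N.
    by rewrite sub_series Nm.
  have := ler_distD y (series (fun n => a n *: x n) m) (series (fun n => a n *: x n) N).
  by rewrite [`|y - _|]distrC; lra.
have h5 := le_trans h3 (ler_wpM2l C_ge0 h4).
rewrite addrAC; apply: le_trans (ler_normD _ _) _.
apply: le_trans (lerD h1 h5) _.
by rewrite le_eqVlt; apply/orP; left; apply/eqP; field; rewrite gt_eqF.
Qed.

Lemma uncond_bound_basic : uncond_basic_seq x.
Proof.
split=> [y /uncond_bound_expansion[a ay]|y a _ ay].
  by exists a; split=> // b yb; exact: uncond_bound_unique ay yb.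
exact: uncond_bound_rearrange.
Qed.

End UnconditionalBound.

(** * Selection of the subsequence *)

(** A subset sum is normed by some [f]. Replacing each [f (a j *: x j)] by [D j s] leaves at most
    [C |s|] and costs at most half the largest coefficient modulus [A]. Singletons give
    [A <= C |s| + A / 2], so [A] is absorbed and the constant becomes [2 * C]. *)
Lemma uncond_bound_of_functionals {R : realType} {V : normedModType R}
    (x : nat -> V) (C : R) : (forall n, `|x n| = 1) ->
  (forall f : V -> R^o, unit_functional f -> exists D : nat -> V -> R^o,
    [/\ forall j, is_linear (D j),
        forall i j, `|D j (x i) - (i == j)%:R * f (x i)| <=
          8^-1 * 2^-1 ^+ i * 2^-1 ^+ j &
        forall n (F : pred nat) y,
          `|\sum_(0 <= j < n | F j) D j y| <= C * `|y|]) ->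
  forall n (a : nat -> R) (F : pred nat),
    `|\sum_(0 <= i < n | F i) a i *: x i| <=
    2 * C * `|\sum_(0 <= i < n) a i *: x i|.
Proof.
move=> x1 xD n a; set s := \sum_(0 <= i < n) a i *: x i.
have key (A : R) (F : pred nat) : 0 <= A -> (forall i, (i < n)%N -> `|a i| <= A) ->
    `|\sum_(0 <= i < n | F i) a i *: x i| <= C * `|s| + A / 2.
  move=> A0 aA; set sF := (X in `|X|).
  have [f [lf fB <-]] := norming_functional sF.
  have [D [lD Dx DB]] := xD f (conj lf fB).
  have -> : f sF = (\sum_(0 <= j < n | F j) D j s) - \sum_(0 <= j < n | F j)
      \sum_(0 <= i < n) a i * (D j (x i) - (i == j)%:R * f (x i)).
    rewrite -sumrB /sF (is_linear_sum lf) big_nat_cond [RHS]big_nat_cond.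
    apply: eq_bigr => j /andP[/andP[_ jn] _].
    rewrite (is_linearZ lf) /s (is_linear_sum (lD j)) -sumrB.
    rewrite -[_ *: f _]/(a j * f (x j)).
    transitivity (\sum_(0 <= i < n | i == j) a i * f (x i)).
      by rewrite big_nat1_eq jn.
    rewrite big_mkcond/=; apply: eq_bigr => i _.
    rewrite (is_linearZ (lD j)) -[_ *: D j _]/(a i * D j (x i)).
    rewrite mulrBr opprB [RHS]addrC subrK.
    by case: eqP; rewrite ?mul1r// mul0r mulr0.
  apply: le_trans (ler_norm _) _; apply: le_trans (ler_normB _ _) _.
  apply: lerD; first exact: DB.
  apply: le_trans (ler_norm_sum _ _ _) _.
  (* Summing over [i] first leaves [A / 4] times a geometric sequence in [j], hence [A / 2]. *)
  apply: le_trans (_ : \sum_(0 <= j < n) A / 4 * 2^-1 ^+ j <= _); last first.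
    rewrite -mulr_sumr; apply: le_trans (ler_wpM2l _ (half_pow_series_le n)) _.
      by rewrite divr_ge0.
    by rewrite le_eqVlt; apply/orP; left; apply/eqP; field.
  rewrite big_mkcond/=; apply: ler_sum => j _.
  have h0 : 0 <= A / 4 * 2^-1 ^+ j by rewrite mulr_ge0 ?divr_ge0// ltW// half_pow_gt0.
  case: (F j) => //; apply: le_trans (ler_norm_sum _ _ _) _.
  apply: le_trans (_ : \sum_(0 <= i < n) A / 8 * 2^-1 ^+ j * 2^-1 ^+ i <= _).
    rewrite big_nat_cond [leRHS]big_nat_cond; apply: ler_sum => i.
    move=> /andP[/andP[_ i_n] _]; rewrite normrM.
    apply: le_trans (ler_pM (normr_ge0 _) (normr_ge0 _) (aA i i_n) (Dx i j)) _.
    by rewrite le_eqVlt; apply/orP; left; apply/eqP; ring.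
  rewrite -mulr_sumr; apply: le_trans (ler_wpM2l _ (half_pow_series_le n)) _.
    by rewrite mulr_ge0 ?divr_ge0// ltW// half_pow_gt0.
  by rewrite le_eqVlt; apply/orP; left; apply/eqP; field.
pose A := \big[Num.max/0]_(0 <= i < n) `|a i|.
have A0 : 0 <= A by exact: bigmax_ge_id.
have aA i : (i < n)%N -> `|a i| <= A.
  move=> i_n; rewrite /A (bigD1_seq i) ?mem_index_iota ?iota_uniq//=.
  by rewrite le_max lexx.
have Cs0 : 0 <= C * `|s|.
  have [f [lf fB _]] := norming_functional (0 : V).
  have [D [_ _ DB]] := xD f (conj lf fB).
  by have := DB 0%N predT s; rewrite big_geq// normr0.
have A2 : A <= 2 * (C * `|s|).
  suff : A <= C * `|s| + A / 2 by lra.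
  rewrite {1}/A big_seq; apply: bigmax_le => [|i]; first by lra.
  rewrite mem_index_iota /= => i_n; have := key A (pred1 i) A0 aA.
  by rewrite big_nat1_eq i_n normrZ x1 mulr1.
move=> F; have := key A F A0 aA; lra.
Qed.

Section Selection.
Context {R : realType} {X Y : normedModType R}.
Variables (T : X -> Y) (S : nat -> X -> X) (y : nat -> Y) (lift : nat -> X).
Variables d e : nat -> R.
Hypotheses (d_gt0 : forall i, 0 < d i) (e_gt0 : forall i, 0 < e i).
Hypothesis y_null : forall f : Y -> R^o, unit_functional f ->
  forall r : R, 0 < r -> exists N, forall n, (N <= n)%N -> `|f (y n)| <= r.
Hypothesis S_cvg : forall x (r : R), 0 < r ->
  exists N, forall k, (N <= k)%N -> `|x - S k x| <= r.
Hypothesis net : forall m (r : R), 0 < r ->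
  exists n (L : seq (Y -> R^o)), (forall u, u \in L -> unit_functional u) /\
    forall f, unit_functional f -> exists k u, [/\ (m <= k < n)%N, u \in L &
      forall x, `|u (T x) - f (T (S k x))| <= r * `|x|].

(** Each step makes three choices in turn: an index where all earlier functionals are small; the
    start of a window, past the previous one and late enough for all lifts so far; the end of the
    window and its functionals, from the finite net. Only finite lists enter, so the selection does
    not depend on any particular [f]. *)
Lemma select_subsequence :
  exists (phi m n : nat -> nat) (L : nat -> seq (Y -> R^o)),
  [/\ forall i, (phi i < phi i.+1)%N, forall i, (n i <= m i.+1)%N,
      forall j i u, (j < i)%N -> u \in L j -> `|u (y (phi i))| <= e i,
      forall l i k, (l <= i)%N -> (m i <= k)%N ->
        `|lift (phi l) - S k (lift (phi l))| <= d i &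
      forall i f, unit_functional f -> exists k u,
        [/\ (m i <= k < n i)%N, u \in L i, unit_functional u &
          forall x, `|u (T x) - f (T (S k x))| <= d i * `|x|]].
Proof.
have /choice[nx nxP] : forall p : nat * nat * seq (Y -> R^o), exists q : nat,
    (p.1.2 < q)%N /\ ((forall u, u \in p.2 -> unit_functional u) ->
      forall u, u \in p.2 -> `|u (y q)| <= e p.1.1).
  move=> [[i p] L] /=.
  suff [q qP] : exists q, (forall u, u \in L -> unit_functional u) ->
      forall n, (q <= n)%N -> forall u, u \in L -> `|u (y n)| <= e i.
    exists (maxn p.+1 q); split; first exact: leq_maxl.
    by move=> Lu u uL; apply: qP => //; exact: leq_maxr.
  elim: L => [|v L [q IH]]; first by exists 0%N.
  have [uv|nv] := pselect (unit_functional v); last first.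
    by exists 0%N => Lu; case: nv; apply: Lu; exact: mem_head.
  have [N NP] := y_null uv (e_gt0 i).
  exists (maxn N q) => Lu n; rewrite geq_max => /andP[Nn qn] u.
  rewrite inE => /predU1P[->|uL]; first exact: NP.
  by apply: IH => // w wL; apply: Lu; rewrite inE wL orbT.
have /choice[mx mxP] : forall p : nat * nat * seq X, exists m : nat,
    (p.1.2 <= m)%N /\ forall x, x \in p.2 -> forall k, (m <= k)%N ->
      `|x - S k x| <= d p.1.1.
  move=> [[i p] xs] /=.
  suff [q qP] : exists q, forall x, x \in xs -> forall k, (q <= k)%N ->
      `|x - S k x| <= d i.
    exists (maxn p q); split; first exact: leq_maxl.
    move=> x xxs k; rewrite geq_max => /andP[_ qk]; exact: qP.
  elim: xs => [|v xs [q IH]]; first by exists 0%N.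
  have [N NP] := S_cvg v (d_gt0 i).
  exists (maxn N q) => x xv k; rewrite geq_max => /andP[Nk qk].
  by move: xv; rewrite inE => /predU1P[->|xxs]; [exact: NP|exact: IH].
have /choice[nt ntP] : forall p : nat * nat, exists q : nat * seq (Y -> R^o),
    (forall u, u \in q.2 -> unit_functional u) /\
    forall f, unit_functional f -> exists k u, [/\ (p.2 <= k < q.1)%N, u \in q.2 &
      forall x, `|u (T x) - f (T (S k x))| <= d p.1 * `|x|].
  by move=> [i m]; have [n [L LP]] := net m (d_gt0 i); exists (n, L).
(* A state collects the last index, the lifts, the end of the last window and
   the functionals chosen so far. *)
pose ph i (s : nat * seq X * nat * seq (Y -> R^o)) := nx (i, s.1.1.1, s.2).
pose xs i s := lift (ph i s) :: s.1.1.2.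
pose ms i s := mx (i, s.1.2, xs i s).
pose st := fix st i := if i is j.+1 then
    let s := st j in let q := nt (j, ms j s) in
    (ph j s, xs j s, q.1, q.2 ++ s.2)
  else (0%N, [::], 0%N, [::]).
pose m i := ms i (st i).
have stL i u : u \in (st i).2 -> unit_functional u.
  elim: i => [//|i IH] /=; rewrite mem_cat => /orP[|/IH//].
  exact: (ntP (i, m i)).1.
exists (fun i => ph i (st i)), m, (fun i => (nt (i, m i)).1), (fun i => (nt (i, m i)).2).
split.
- by move=> i; exact: (nxP (i.+1, ph i (st i), (st i.+1).2)).1.
- by move=> i; exact: (mxP (i.+1, (nt (i, m i)).1, xs i.+1 (st i.+1))).1.
- move=> j i u ji uL; apply: (nxP (i, (st i).1.1.1, (st i).2)).2 => //=.
    exact: stL.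
  elim: i ji => [//|i IH]; rewrite ltnS leq_eqVlt => /predU1P[<-|/IH] /=.
    by rewrite mem_cat uL.
  by rewrite mem_cat => ->; rewrite orbT.
- move=> l i k li mk; apply: (mxP (i, (st i).1.2, xs i (st i))).2 => //=.
  rewrite /xs inE; move: li; rewrite leq_eqVlt => /predU1P[->|li].
    by rewrite eqxx.
  apply/orP; right; elim: i li {mk} => [//|i IH].
  rewrite ltnS leq_eqVlt => /predU1P[->|/IH h] /=; rewrite /xs inE ?eqxx//.
  by rewrite h orbT.
- move=> i f uf; have [k [u [mkn uL uP]]] := (ntP (i, m i)).2 f uf.
  by exists k, u; split=> //; exact: (ntP (i, m i)).1.
Qed.

End Selection.

(** * Differences of functionals as blocks of coordinates *)

Lemma block_sums {V : zmodType} (t : nat -> nat) (c : nat -> V) N (F : pred nat) :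
  (forall j, (t j <= t j.+1)%N) ->
  exists G : pred nat, \sum_(0 <= j < N | F j)
      (\sum_(0 <= i < t j.+1) c i - \sum_(0 <= i < t j) c i) =
    \sum_(0 <= i < t N | G i) c i.
Proof.
move=> tS; elim: N => [|N [G GP]]; first by exists pred0; rewrite big_geq// big_pred0.
(* The blocks are disjoint, so the new one is kept or dropped as [F N] says; indices below [t 0]
   were left out by [pred0]. *)
exists (fun i => if (i < t N)%N then G i else F N).
rewrite big_mkcond big_nat_recr//= -big_mkcond GP.
rewrite [RHS](big_cat_nat (leq0n _) (tS N))/=; congr (_ + _).
  rewrite big_nat_cond [RHS]big_nat_cond; apply: eq_bigl => i.
  by case: (ltnP i (t N)); rewrite ?andbF.
rewrite (big_cat_nat (leq0n _) (tS N))/= addrAC subrr add0r.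
rewrite [RHS]big_nat_cond; case: (F N).
  rewrite big_nat_cond; apply: eq_bigl => i.
  by rewrite andbT; case: (leqP (t N) i); rewrite ?andbF ?andbT.
by rewrite big_pred0// => i; case: (leqP (t N) i); rewrite ?andbF.
Qed.

(** The second summand is four times the first, whence the 5; with [c = 40^-1] this yields the
    factor [8^-1] required of the blocks. *)
Lemma quarter_sum_le {R : realType} (c : R) i j : 0 <= c -> (i < j.+1)%N ->
  c * 2^-1 ^+ j.+1 * 2^-1 ^+ j.+1 + c * 2^-1 ^+ j * 2^-1 ^+ j <=
  5 * c * 2^-1 ^+ i * 2^-1 ^+ j.+1.
Proof.
move=> c0 ij; have hj := ltW (half_pow_gt0 (R := R) j).
have hij : 2^-1 ^+ j <= 2^-1 ^+ i :> R by exact: half_pow_le.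
rewrite !exprS; have := ler_wpM2l (mulr_ge0 c0 hj) hij.
have := mulr_ge0 (mulr_ge0 c0 hj) hj; lra.
Qed.

Section Transfer.
Context {R : realType} {X Y : normedModType R}.
Variables (T : X -> Y) (c : nat -> X -> X) (K MT CT : R).
Hypotheses (lT : is_linear T) (MT_gt0 : 0 < MT) (CT_gt0 : 0 < CT) (K_ge0 : 0 <= K).
Hypothesis T_bound : forall x, `|T x| <= MT * `|x|.
Hypothesis T_lift : forall y, exists2 x, T x = y & `|x| <= CT * `|y|.
Hypothesis c_bound : forall n (F : pred nat) x,
  `|\sum_(0 <= i < n | F i) c i x| <= K * `|x|.

Let S n x := \sum_(0 <= i < n) c i x.
(** The squared power provides decay in two indices. For [d], the errors [d j * CT] and [MT * d j]
    met below add up to [e j]. *)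
Let e j : R := 40^-1 * 2^-1 ^+ j * 2^-1 ^+ j.
Let d j : R := e j / (CT + MT).

Variables (x : nat -> X) (f : Y -> R^o) (t : nat -> nat) (u : nat -> Y -> R^o).
Hypotheses (x_bound : forall i, `|x i| <= CT) (f_unit : unit_functional f).
Hypothesis t_mono : forall j, (t j <= t j.+1)%N.
Hypothesis u_lin : forall j, is_linear (u j).
Hypothesis u_early : forall j i, (j < i)%N -> `|u j (T (x i))| <= e i.
Hypothesis x_head : forall i j, (i <= j)%N -> `|x i - S (t j) (x i)| <= d j.
Hypothesis u_close : forall j z, `|u j (T z) - f (T (S (t j) z))| <= d j * `|z|.

(** Shifted sequences starting at zero: [D 0] is [u 0], and block [j] runs over the coordinates from
    [tp j] up to [t j], excluded. *)
Let up j : Y -> R^o := if j is k.+1 then u k else fun=> 0.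
Let tp j := if j is k.+1 then t k else 0%N.
Let D j := u j \- up j.

Let CM_gt0 : 0 < CT + MT. Proof. exact: addr_gt0. Qed.

(** Passing from [u j] to [f] on the truncated [x i] costs [d j * CT]; restoring the part cut off
    costs [MT * d j]. *)
Lemma late_functional_close i j : (i <= j)%N -> `|u j (T (x i)) - f (T (x i))| <= e j.
Proof.
move=> ij; have [lf fB] := f_unit.
have -> : u j (T (x i)) - f (T (x i)) = (u j (T (x i)) - f (T (S (t j) (x i))))
    - f (T (x i - S (t j) (x i))).
  by rewrite (is_linearB lT) (is_linearB lf); ring.
apply: le_trans (ler_normB _ _) _.
have d0 : 0 <= d j by exact: le_trans (normr_ge0 _) (x_head ij).
have h1 := le_trans (u_close j (x i)) (ler_wpM2l d0 (x_bound i)).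
have h2 : `|f (T (x i - S (t j) (x i)))| <= MT * d j.
  apply: le_trans (fB _) _; apply: le_trans (T_bound _) _.
  by rewrite ler_wpM2l ?(ltW MT_gt0)// x_head.
apply: le_trans (lerD h1 h2) _; rewrite [MT * _]mulrC -mulrDr /d divfK// gt_eqF//.
Qed.

Lemma up_lin j : is_linear (up j).
Proof. by case: j => [|j] //= a y z; rewrite scaler0 addr0. Qed.

(** At [T (x i)]: for [i = j], [u j] is close to [f] and its predecessor is small; for [j < i] both
    are small; for [i < j] both are close to [f], which cancels. *)
Lemma blocks_biorthogonal i j :
  `|D j (T (x i)) - (i == j)%:R * f (T (x i))| <= 8^-1 * 2^-1 ^+ i * 2^-1 ^+ j.
Proof.
have c0 : 0 <= 40^-1 :> R by rewrite invr_ge0.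
have e0 k : 0 <= e k by rewrite /e !mulr_ge0// ltW// half_pow_gt0.
have up_early : (j <= i)%N -> `|up j (T (x i))| <= e i.
  by case: (j) => [|k] /= ji; [rewrite normr0|exact: u_early].
have ei : (j <= i)%N -> e i + e i <= 8^-1 * 2^-1 ^+ i * 2^-1 ^+ j.
  move=> ji; have hi := ltW (half_pow_gt0 (R := R) i).
  have := ler_wpM2l hi (half_pow_le (R := R) ji); have := mulr_ge0 hi hi.
  by rewrite /e; lra.
have [ij|ji|ij] := ltngtP i j; last first.
- subst j; rewrite mul1r /D /= addrAC.
  apply: le_trans (ler_normB _ _) _; apply: le_trans (ei (leqnn i)).
  by apply: lerD; [exact: late_functional_close|exact: up_early].
- rewrite mul0r subr0 /D /=; apply: le_trans (ler_normB _ _) _.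
  apply: le_trans (ei (ltnW ji)); apply: lerD; last exact/up_early/ltnW.
  exact: u_early.
rewrite mul0r subr0; case: j ij {up_early ei} => [//|j] ij; rewrite /D /=.
have -> : u j.+1 (T (x i)) - u j (T (x i)) = (u j.+1 (T (x i)) - f (T (x i)))
   - (u j (T (x i)) - f (T (x i))) by ring.
apply: le_trans (ler_normB _ _) _.
apply: le_trans (_ : e j.+1 + e j <= _).
  by apply: lerD; apply: late_functional_close; rewrite // ltnW.
by apply: le_trans (quarter_sum_le c0 ij) _; lra.
Qed.

(** On a lift [z] of [y], [D j] is close to [f T] of the block [j] of coordinates of [z]. The
    selected blocks form one coordinate sum, of norm at most [K |z|] whatever [F] is, and the errors
    are summable. *)
Lemma blocks_bounded n (F : pred nat) y : `|\sum_(0 <= j < n | F j) D j y| <=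
  (MT * K + 6 * (40^-1 / (CT + MT))) * CT * `|y|.
Proof.
have [z <- zy] := T_lift y; have [lf fB] := f_unit.
pose D0 : R := 40^-1 / (CT + MT).
have D00 : 0 <= D0 by rewrite divr_ge0 ?(ltW CM_gt0)// invr_ge0.
have dD j : d j <= D0 * 2^-1 ^+ j.
  have -> : d j = D0 * 2^-1 ^+ j * 2^-1 ^+ j.
    by rewrite /d /e /D0; field; rewrite gt_eqF.
  have h : 0 <= D0 * 2^-1 ^+ j by rewrite mulr_ge0// ltW// half_pow_gt0.
  by rewrite ler_piMr//; have := half_pow_le (R := R) (leq0n j); rewrite expr0.
rewrite -/D0; clearbody D0.
have uc j : `|u j (T z) - f (T (S (tp j.+1) z))| <= D0 * `|z| * 2^-1 ^+ j.
  by apply: le_trans (u_close j z) _; rewrite [leRHS]mulrAC ler_wpM2r.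
(* The factor 2 pays for the index shift: the error of [up j.+1] is that of [u j]. *)
have upc j : `|up j (T z) - f (T (S (tp j) z))| <= 2 * (D0 * `|z|) * 2^-1 ^+ j.
  case: j => [|j] /=.
    rewrite /S big_geq// (is_linear0 lT) (is_linear0 lf) subr0 normr0.
    by rewrite !mulr_ge0.
  by apply: le_trans (uc j) _; rewrite exprS; lra.
have [G GP] := @block_sums X tp (c^~ z) n F ltac:(by case=> [|j] /=).
have -> : \sum_(0 <= j < n | F j) D j (T z) =
    f (T (\sum_(0 <= i < tp n | G i) c i z)) +
    \sum_(0 <= j < n | F j) ((u j (T z) - f (T (S (tp j.+1) z)))
      - (up j (T z) - f (T (S (tp j) z)))).
  rewrite -GP (is_linear_sum lT) (is_linear_sum lf) -big_split/=.
  apply: eq_bigr => j _; rewrite (is_linearB lT) (is_linearB lf) /D /S /=.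
  ring.
apply: le_trans (ler_normD _ _) _.
have h1 : `|f (T (\sum_(0 <= i < tp n | G i) c i z))| <= MT * K * `|z|.
  apply: le_trans (fB _) _; apply: le_trans (T_bound _) _.
  by rewrite -mulrA ler_wpM2l ?(ltW MT_gt0).
have h2 : `|\sum_(0 <= j < n | F j) ((u j (T z) - f (T (S (tp j.+1) z)))
      - (up j (T z) - f (T (S (tp j) z))))| <= 6 * D0 * `|z|.
  apply: le_trans (ler_norm_sum _ _ _) _.
  (* The 3 collects one error from [u] and two from [up]; the geometric sum doubles it to 6. *)
  apply: le_trans (_ : \sum_(0 <= j < n) 3 * (D0 * `|z|) * 2^-1 ^+ j <= _).
    rewrite big_mkcond/=; apply: ler_sum => j _.
    have h : 0 <= 3 * (D0 * `|z|) * 2^-1 ^+ j.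
      by rewrite !mulr_ge0// ltW// half_pow_gt0.
    case: (F j) => //; apply: le_trans (ler_normB _ _) _.
    by apply: le_trans (lerD (uc j) (upc j)) _; lra.
  rewrite -mulr_sumr; apply: le_trans (ler_wpM2l _ (half_pow_series_le n)) _.
    by rewrite !mulr_ge0.
  by lra.
apply: le_trans (lerD h1 h2) _; rewrite -mulrDl -mulrA ler_wpM2l//.
by rewrite addr_ge0// mulr_ge0// ltW.
Qed.

End Transfer.

(** * Property (WU) of the quotient *)

Theorem theoremA (R : realType) (X Y : completeNormedModType R) :
  has_shrinking_uncond_fdd X ->
  (exists T : X -> Y, bounded_linear T /\ (forall y : Y, exists x : X, T x = y)) ->
  property_WU Y.
Proof.
move=> [E [uE sE]] [T [bT sT]] y y1 ynull.
have [c [K [K0 lc cE cx cK]]] := uncond_fdd_projections uE.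
have [MT MT0 TM] := bounded_linear_bound bT.
have [CT CT0 Tlift] := open_mapping bT sT.
have [lT _] := bT.
have /choice[lift liftP] : forall n, exists x, T x = y n /\ `|x| <= CT.
  by move=> n; have [x Tx xC] := Tlift (y n); exists x; rewrite y1 mulr1 in xC.
pose S n x := \sum_(0 <= i < n) c i x.
pose e j : R := 40^-1 * 2^-1 ^+ j * 2^-1 ^+ j.
pose d j : R := e j / (CT + MT).
have e0 j : 0 < e j by rewrite /e !mulr_gt0 ?half_pow_gt0// invr_gt0.
have d0 j : 0 < d j by rewrite divr_gt0// addr_gt0.
have cK1 n x : `|c n x| <= K * `|x|.
  have := cK n.+1 (pred1 n) x.
  by rewrite big_nat1_eq ltnSn.
have Sfin n := fdd_finite_rank n uE.1 (ltW K0) cE cK1.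
have Sshr := shrinking_projection sE cE cx (fun n => cK n predT) (ltW K0).
have net m r (r0 : 0 < r) := truncation_finite_net bT Sfin Sshr m r0.
have yn (f : Y -> R^o) : unit_functional f -> forall r : R, 0 < r ->
    exists N, forall n, (N <= n)%N -> `|f (y n)| <= r.
  move=> [lf fB] r r0.
  have df : dual_elt f.
    by apply: (@bound_bounded_linear _ _ _ _ 1) => // z; rewrite mul1r.
  have /cvg_seqP/(_ r r0)[N NP] := ynull f df.
  by exists N => n Nn; have := NP n Nn; rewrite subr0.
have Scvg x (r : R) : 0 < r -> exists N, forall k, (N <= k)%N -> `|x - S k x| <= r.
  move=> r0; have /cvg_seqP/(_ r r0)[N NP] := cx x.
  by exists N => k Nk; rewrite distrC; exact: NP.
have [phi [m [n [L [phiS nm early head Lnet]]]]] :=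
  select_subsequence lift d0 e0 yn Scvg net.
exists phi; split=> //.
have nrm i : `|(y \o phi) i| = 1 by exact: y1.
pose C := (MT * K + 6 * (40^-1 / (CT + MT))) * CT.
have C0 : 0 <= C.
  by rewrite mulr_ge0 ?(ltW CT0)// addr_ge0// !mulr_ge0 ?ltW// invr_gt0 addr_gt0.
apply: (uncond_bound_basic nrm (mulr_ge0 (ler0n _ 2) C0)).
apply: (uncond_bound_of_functionals nrm) => f uf.
(* With [phi] already fixed, this [f] selects one truncation level and one functional in each
   window; the windows follow one another, so the levels increase. *)
have /choice[p pP] : forall i, exists p : nat * (Y -> R^o),
    [/\ (m i <= p.1 < n i)%N, p.2 \in L i, unit_functional p.2 &
        forall x, `|p.2 (T x) - f (T (S p.1 x))| <= d i * `|x|].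
  by move=> i; have [k [u kuP]] := Lnet i f uf; exists (k, u).
pose t i := (p i).1; pose u i := (p i).2.
have tS j : (t j <= t j.+1)%N.
  have [/andP[_ tn] _ _ _] := pP j; have [/andP[mt _] _ _ _] := pP j.+1.
  exact: leq_trans (ltnW tn) (leq_trans (nm j) mt).
have ulin j : is_linear (u j) by have [_ _ [lu _] _] := pP j.
pose x i := lift (phi i).
have xy i : T (x i) = y (phi i) by exact: (liftP (phi i)).1.
have uearly j i : (j < i)%N -> `|u j (T (x i))| <= e i.
  by move=> ji; rewrite xy; apply: early ji _; have [] := pP j.
have xhead i j : (i <= j)%N -> `|x i - S (t j) (x i)| <= d j.
  by move=> ij; apply: head ij _; have [/andP[]] := pP j.
have uclose j z : `|u j (T z) - f (T (S (t j) z))| <= d j * `|z|.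
  by have [_ _ _ h] := pP j; exact: h.
have xb i : `|x i| <= CT by exact: (liftP (phi i)).2.
exists (fun j => u j \- (if j is k.+1 then u k else fun=> 0)); split.
- by move=> j; apply: is_linear_funB => //; exact: up_lin.
- move=> i j; rewrite /= -xy.
  exact: (blocks_biorthogonal lT MT0 CT0 TM xb uf uearly xhead uclose).
- exact: (blocks_bounded lT MT0 CT0 (ltW K0) TM Tlift cK uf tS uclose).
Qed.
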